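(* Let $G$ be a finitely generated acylindrically hyperbolic group with trivial finite radical. Then $G$ is sharply MIF.
   Context: A group is acylindrically hyperbolic if it admits a nonelementary acylindrical action by isometries on a (Gromov-)hyperbolic metric space. The finite radical of an acylindrically hyperbolic group $G$ is its unique maximal finite normal subgroup. Throughout, $x$ is a free variable generating an infinite cyclic group $\langle x\rangle\cong\mathbb{Z}$. For $w(x)\in G\ast\langle x\rangle$ and $g\in G$, $w(g)\in G$ denotes the image of $w(x)$ under the homomorphism $G\ast\langle x\rangle\to G$ that is the identity on $G$ and sends $x$ to $g$. The identity of $G$ is $e_G$. A group $G$ is mixed-identity free (MIF) if for every non-trivial $w(x)\in G\ast\langle x\rangle$ there exists $g\in G$ with $w(g)\neq e_G$. Let $G$ be MIF and generated by a finite set $S$. The complexity of a non-trivial $w(x)\in G\ast\langle x\rangle$ is the minimal word length (with respect to $S$) of an element $g\in G$ satisfying $w(g)\neq e_G$. The MIF growth function $\mathcal{M}_G^S:\mathbb{N}\to\mathbb{N}$ is defined by letting $\mathcal{M}_G^S(n)$ be the maximal complexity of a non-trivial element of $G\ast\langle x\rangle$ of word length at most $n$ with respect to $S\cup\{x\}$. A finitely generated group $G$ is sharply MIF if it is MIF and $\mathcal{M}_G^S$ grows at most logarithmically, i.e. for a finite generating set $S$ (equivalently, for every finite generating set) there is a constant $C>0$ such that $\mathcal{M}_G^S(n)\leq C\log n$ for all integers $n\geq 2$. *)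

(* Defs.v *)
From HB Require Import structures.
From mathcomp Require Import all_boot all_order all_algebra generic_quotient.
From mathcomp Require Import all_classical all_reals all_analysis.

Set Implicit Arguments.
Unset Strict Implicit.
Unset Printing Implicit Defensive.

Import Order.TTheory GRing.Theory Num.Theory.
Import numFieldNormedType.Exports.

Local Open Scope classical_set_scope.
Local Open Scope ring_scope.
Local Open Scope quotient_scope.

(* The free product G * <x> is the monoid of words over the disjoint union of
   G and {x, x^-1}, modulo the congruence generated by the multiplication
   table of G and by the cancellations of x and x^-1.  The letter inr true
   stands for x, and inr false for x^-1. *)
Section MixedWords.
Variable G : groupType.
Local Open Scope group_scope.

Definition pre_word := seq (G + bool).

Inductive word_eq : pre_word -> pre_word -> Prop :=
| WordRefl u : word_eq u u
| WordSym u v : word_eq u v -> word_eq v u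
| WordTrans v u w : word_eq u v -> word_eq v w -> word_eq u w
| WordCat u u' v v' :
    word_eq u u' -> word_eq v v' -> word_eq (u ++ v) (u' ++ v')
| WordOne : word_eq [:: inl 1] [::]
| WordMul g h : word_eq [:: inl g; inl h] [:: inl (g * h)]
| WordCancel b : word_eq [:: inr b; inr (~~ b)] [::].

Definition word_eqb (u v : pre_word) : bool := `[< word_eq u v >].

Lemma word_eqb_refl : reflexive word_eqb.
Proof. by move=> u; apply/asboolP; exact: WordRefl. Qed.

Lemma word_eqb_sym : symmetric word_eqb.
Proof. by move=> u v; apply/asboolP/asboolP; exact: WordSym. Qed.

Lemma word_eqb_trans : transitive word_eqb.
Proof.
by move=> v u w /asboolP uv /asboolP vw; apply/asboolP; exact: WordTrans uv vw.
Qed.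

Canonical word_equiv :=
  EquivRel word_eqb word_eqb_refl word_eqb_sym word_eqb_trans.

Definition mixed_word := {eq_quot word_equiv}.
HB.instance Definition _ := Choice.on mixed_word.
HB.instance Definition _ := Quotient.on mixed_word.
HB.instance Definition _ := EqQuotient.on mixed_word.

Lemma mixed_wordP (u v : pre_word) :
  (\pi_mixed_word u = \pi_mixed_word v) <-> word_eq u v.
Proof.
split; first by move=> /eqmodP /asboolP.
by move=> uv; apply/eqmodP/asboolP.
Qed.

Lemma repr_word_eq (u : pre_word) : word_eq (repr (\pi_mixed_word u)) u.
Proof. by apply/mixed_wordP; rewrite reprK. Qed.

Definition inv_letter (a : G + bool) : G + bool :=
  match a with inl g => inl g^-1 | inr b => inr (~~ b) end.

Definition inv_word (u : pre_word) : pre_word := rev (map inv_letter u).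

Lemma inv_word_cat u v : inv_word (u ++ v) = inv_word v ++ inv_word u.
Proof. by rewrite /inv_word map_cat rev_cat. Qed.

Lemma inv_word_congr u v : word_eq u v -> word_eq (inv_word u) (inv_word v).
Proof.
elim=> {u v}.
- by move=> u; exact: WordRefl.
- by move=> u v _; exact: WordSym.
- by move=> v u w _ uv _; exact: WordTrans.
- by move=> u u' v v' _ uu' _ vv'; rewrite !inv_word_cat; exact: WordCat.
- by rewrite /inv_word /= invg1; exact: WordOne.
- by move=> g h; rewrite /inv_word /= invgM; exact: WordMul.
- move=> b; rewrite /inv_word /= negbK.
  by have := WordCancel b.
Qed.

Lemma word_mulVg u : word_eq (inv_word u ++ u) [::].
Proof.
elim: u => [|a u IHu]; first exact: WordRefl.
have aVa : word_eq (inv_word [:: a] ++ [:: a]) [::].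
  case: a => [g|b]; rewrite /inv_word /=.
    by apply: WordTrans (WordMul _ _) _; rewrite mulVg; exact: WordOne.
  by have := WordCancel (~~ b); rewrite negbK.
rewrite -cat1s inv_word_cat -catA (catA _ [:: a] u); apply: WordTrans IHu.
by apply/WordCat/(@WordCat _ [::] u u) => //; exact: WordRefl.
Qed.

Lemma inv_wordK : involutive inv_word.
Proof.
move=> u; rewrite /inv_word map_rev revK mapK//.
by case=> [g|b] /=; rewrite ?invgK ?negbK.
Qed.

Definition mw_one : mixed_word := \pi_mixed_word [::].
Definition mw_mul (v w : mixed_word) : mixed_word :=
  \pi_mixed_word (repr v ++ repr w).
Definition mw_inv (w : mixed_word) : mixed_word :=
  \pi_mixed_word (inv_word (repr w)).

Lemma mw_pi (w : mixed_word) : exists u, w = \pi_mixed_word u.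
Proof. by exists (repr w); rewrite reprK. Qed.

Lemma mw_mul_pi u v :
  mw_mul (\pi_mixed_word u) (\pi_mixed_word v) = \pi_mixed_word (u ++ v).
Proof. by apply/mixed_wordP; apply: WordCat; exact: repr_word_eq. Qed.

Lemma mw_inv_pi u : mw_inv (\pi_mixed_word u) = \pi_mixed_word (inv_word u).
Proof. by apply/mixed_wordP/inv_word_congr/repr_word_eq. Qed.

Lemma mw_mulA : associative mw_mul.
Proof.
move=> u v w; have [a ->] := mw_pi u.
have [b ->] := mw_pi v; have [c ->] := mw_pi w.
by rewrite !mw_mul_pi catA.
Qed.

Lemma mw_mul1 : left_id mw_one mw_mul.
Proof. by move=> w; have [u ->] := mw_pi w; rewrite /mw_one mw_mul_pi. Qed.

Lemma mw_mulr1 : right_id mw_one mw_mul.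
Proof.
by move=> w; have [u ->] := mw_pi w; rewrite /mw_one mw_mul_pi cats0.
Qed.

Lemma mw_mulV : left_inverse mw_one mw_inv mw_mul.
Proof.
move=> w; have [u ->] := mw_pi w; rewrite mw_inv_pi mw_mul_pi.
by apply/mixed_wordP/word_mulVg.
Qed.

Lemma mw_mulrV : right_inverse mw_one mw_inv mw_mul.
Proof.
move=> w; have [u ->] := mw_pi w; rewrite mw_inv_pi mw_mul_pi.
apply/mixed_wordP; rewrite -{1}[u]inv_wordK; exact: word_mulVg.
Qed.

HB.instance Definition _ :=
  isGroup.Build mixed_word mw_mulA mw_mul1 mw_mulr1 mw_mulV mw_mulrV.

Definition mw_const (g : G) : mixed_word := \pi_mixed_word [:: inl g].
Definition mw_var : mixed_word := \pi_mixed_word [:: inr true].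

Definition eval_letter (g : G) (a : G + bool) : G :=
  match a with inl h => h | inr true => g | inr false => g^-1 end.

Definition eval_word (g : G) (u : pre_word) : G :=
  \big[*%g/1]_(a <- u) eval_letter g a.

(* w(g), the image of w(x) under the homomorphism that fixes G and maps x to g;
   its characteristic properties are proved just below. *)
Definition mw_eval (g : G) (w : mixed_word) : G := eval_word g (repr w).

Lemma eval_word_congr g u v : word_eq u v -> eval_word g u = eval_word g v.
Proof.
elim=> {u v} //.
- by move=> v u w _ -> _ ->.
- move=> u u' v v' _ uu' _ vv'; rewrite /eval_word !big_cat /=.
  by rewrite -!/(eval_word _ _) uu' vv'.
- by rewrite /eval_word big_seq1 big_nil.
- by move=> h k; rewrite /eval_word !big_cons big_nil /= !mulg1.
- by move=> [];
    rewrite /eval_word !big_cons big_nil /= !mulg1 ?mulgV ?mulVg.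
Qed.

Lemma mw_eval_pi g u : mw_eval g (\pi_mixed_word u) = eval_word g u.
Proof. exact/eval_word_congr/repr_word_eq. Qed.

Lemma mw_evalM g : {morph mw_eval g : v w / v * w}.
Proof.
move=> v w; have [a ->] := mw_pi v; have [b ->] := mw_pi w.
by rewrite [_ * _]mw_mul_pi !mw_eval_pi /eval_word big_cat.
Qed.

Lemma mw_eval_const g h : mw_eval g (mw_const h) = h.
Proof. by rewrite mw_eval_pi /eval_word big_seq1. Qed.

Lemma mw_eval_var g : mw_eval g mw_var = g.
Proof. by rewrite mw_eval_pi /eval_word big_seq1. Qed.

Lemma mw_constM : {morph mw_const : g h / g * h}.
Proof.
move=> g h; apply/esym; rewrite [LHS]mw_mul_pi.
by apply/mixed_wordP; exact: WordMul.
Qed.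

End MixedWords.

Section WordLength.
Variable G : groupType.
Local Open Scope group_scope.

Definition spells (S : set G) (s : seq G) (g : G) : Prop :=
  (forall a, a \in s -> S a \/ S a^-1) /\ \big[*%g/1]_(a <- s) a = g.

Definition generates (S : set G) : Prop := forall g, exists s, spells S s g.

Definition finitely_generated : Prop :=
  exists S : set G, finite_set S /\ generates S.

(* infimum 0%N A is the minimum of A when A is nonempty, and 0 otherwise. *)
Definition word_length (S : set G) (g : G) : nat :=
  infimum 0%N [set size s | s in [set s | spells S s g]].

End WordLength.

Section MIF.
Variable G : groupType.
Local Open Scope group_scope.

Definition mixed_identity_free : Prop :=
  forall w : mixed_word G, w <> 1 -> exists g : G, mw_eval g w <> 1.

Definition mif_complexity (S : set G) (w : mixed_word G) : nat :=
  infimum 0%N [set word_length S g | g in [set g | mw_eval g w <> 1]].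

Definition mixed_generators (S : set G) : set (mixed_word G) :=
  @mw_const G @` S `|` [set mw_var G].

(* For a finite generating set S, the set below is finite, so that the supremum
   is a maximum (and is 0 for n = 0, where the set is empty): see
   mif_growthP. *)
Definition mif_growth (S : set G) (n : nat) : nat :=
  supremum 0%N [set mif_complexity S w | w in
    [set w | w <> 1 /\ (word_length (mixed_generators S) w <= n)%N]].

End MIF.

Lemma infimum_natP (A : set nat) m : (A !=set0) ->
  (infimum 0%N A <= m)%N <-> exists2 k, A k & (k <= m)%N.
Proof.
move=> A0.
have [k Ak kmin] : exists2 k, A k & forall j, A j -> (k <= j)%N.
  have exA : exists k, `[< A k >] by case: A0 => k Ak; exists k; exact/asboolP.
  case: (ex_minnP exA) => k /asboolP Ak kmin; exists k => // j Aj.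
  exact/kmin/asboolP.
have -> : infimum 0%N A = k.
  rewrite /infimum ifF; last by apply/negbTE/set0P.
  have Ik : infimums A k by split=> [j /kmin//|j]; apply.
  by apply: (xget_unique 0%N Ik) => j Ij; exact: is_subset1_infimums Ij Ik.
split=> [km|[j Aj jm]]; first by exists k.
exact: leq_trans (kmin _ Aj) jm.
Qed.

Lemma supremum_natP (A : set nat) m : finite_set A ->
  (supremum 0%N A <= m)%N <-> forall k, A k -> (k <= m)%N.
Proof.
move=> Afin; have [->|/set0P A0] := eqVneq A set0.
  by rewrite supremum0.
have [b bA] : exists b, forall k, A k -> (k <= b)%N.
  have /finite_seqP[s ->] := Afin.
  by exists (\max_(i <- s) i)%N => k ks; exact: leq_bigmax_seq.
have [k Ak kmax] : exists2 k, A k & forall j, A j -> (j <= k)%N.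
  have exA : exists k, `[< A k >] by case: A0 => k Ak; exists k; exact/asboolP.
  have ub j : `[< A j >] -> (j <= b)%N by move=> /asboolP/bA.
  case: (ex_maxnP exA ub) => k /asboolP Ak kmax; exists k => // j Aj.
  exact/kmax/asboolP.
have -> : supremum 0%N A = k.
  rewrite /supremum ifF; last by apply/negbTE/set0P.
  have Ik : supremums A k by split=> [j /kmax//|j]; apply.
  by apply: (xget_unique 0%N Ik) => j Ij; exact: is_subset1_supremums Ij Ik.
by split=> [km j /kmax jk|]; [exact: leq_trans jk km | apply].
Qed.

Section GrowthTheory.
Variable G : groupType.
Local Open Scope group_scope.

Lemma word_length_leP (S : set G) g n : generates S ->
  (word_length S g <= n)%N <-> exists2 s, spells S s g & (size s <= n)%N.
Proof.
move=> gS; rewrite infimum_natP; last first.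
  by have [s ss] := gS g; exists (size s), s.
split=> [[_ [s ss <-] sn]|[s ss sn]]; first by exists s.
by exists (size s) => //; exists s.
Qed.

Lemma spells_cat (S : set G) s t g h :
  spells S s g -> spells S t h -> spells S (s ++ t) (g * h).
Proof.
move=> [sS <-] [tS <-]; split; last by rewrite big_cat.
by move=> a; rewrite mem_cat => /orP[/sS|/tS].
Qed.

Lemma mixed_generates (S : set G) :
  generates S -> generates (mixed_generators S).
Proof.
move=> gS w; have [u ->] := mw_pi w.
elim: u => [|a u [t [tS te]]].
  by exists [::]; split=> //; rewrite big_nil.
have [s [sS se]] : exists s,
    spells (mixed_generators S) s (\pi_(mixed_word G) [:: a]).
  case: a => [g|b].
    have [s [sS <-]] := gS g.
    exists (map (@mw_const G) s); split.
      move=> _ /mapP[c /sS + ->]; case=> Sc; [left|right]; left.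
        by exists c.
      exists c^-1 => //; apply/esym.
      apply: (mulgI (mw_const c)); rewrite mulgV -mw_constM mulgV.
      by apply/esym/mixed_wordP/WordOne.
    rewrite big_map.
    change (\prod_(i <- s) mw_const i = mw_const (\prod_(i <- s) i)).
    apply/esym/(big_morph _ (@mw_constM G)).
    by apply/mixed_wordP/WordOne.
  exists [:: \pi_(mixed_word G)[:: inr b]]; split; last by rewrite big_seq1.
  move=> c; rewrite inE => /eqP ->; case: b; first by left; right.
  right; right; apply/esym.
  change (mw_var G = mw_inv (\pi_(mixed_word G) [:: inr false])).
  by rewrite mw_inv_pi.
exists (s ++ t); rewrite -cat1s; split.
  by move=> c; rewrite mem_cat => /orP[/sS|/tS].
by rewrite big_cat /= se te; exact: mw_mul_pi.
Qed.

Lemma finite_words (T : choiceType) (A : set T) n : finite_set A ->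
  finite_set [set s : seq T | (forall a, a \in s -> A a) /\ (size s <= n)%N].
Proof.
move=> Afin; elim: n => [|n IHn].
  apply: (@sub_finite_set _ _ [set [::]]) => // s [_].
  by rewrite leqn0 => /nilP ->.
apply: (@sub_finite_set _ _ ([set [::]] `|`
    (fun p => p.1 :: p.2) @`
      (A `*` [set s : seq T |
         (forall a, a \in s -> A a) /\ (size s <= n)%N]))).
  move=> [|a s] [sA ss]; first by left.
  right; exists (a, s) => //; split; first by apply: sA; exact: mem_head.
  by split=> // b bs; apply: sA; rewrite inE bs orbT.
by rewrite finite_setU; split=> //; apply/finite_image/finite_setX.
Qed.

Lemma finite_ball (S : set G) n : finite_set S -> generates S ->
  finite_set [set g | (word_length S g <= n)%N].
Proof.
move=> Sfin gS.
have Tfin : finite_set (S `|` [set a^-1 | a in S]).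
  by rewrite finite_setU; split=> //; exact: finite_image.
refine (sub_finite_set _ (finite_image (fun s : seq G => \prod_(a <- s) a)
  (@finite_words G _ n Tfin))).
move=> g /= /(word_length_leP _ _ gS)[s [sS <-] sn]; exists s => //.
split=> // a /sS[]; first by left.
by move=> Sa; right; exists a^-1 => //; rewrite invgK.
Qed.

End GrowthTheory.

Section GrowthBound.
Variable G : groupType.
Local Open Scope group_scope.

Lemma mif_growthP (S : set G) n m :
  mixed_identity_free G -> finite_set S -> generates S ->
  (mif_growth S n <= m)%N <->
  forall w : mixed_word G, w <> 1 ->
    (word_length (mixed_generators S) w <= n)%N ->
    exists2 g : G, mw_eval g w <> 1 & (word_length S g <= m)%N.
Proof.
move=> Gmif Sfin gS.
have cP (w : mixed_word G) : w <> 1 -> (mif_complexity S w <= m)%N <->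
    exists2 g : G, mw_eval g w <> 1 & (word_length S g <= m)%N.
  move=> w1; rewrite infimum_natP; last first.
    by have [g wg] := Gmif _ w1; exists (word_length S g), g.
  split=> [[_ [g wg <-] gm]|[g wg gm]]; first by exists g.
  by exists (word_length S g) => //; exists g.
rewrite supremum_natP; last first.
  apply: finite_image; apply: sub_finite_set; last first.
    apply: (@finite_ball _ (mixed_generators S) n); last exact: mixed_generates.
    by rewrite finite_setU; split=> //; apply: finite_image.
  by move=> w [].
split=> [H w w1 wn|H _ [w [w1 wn] <-]]; last by apply/cP => //; exact: H.
by apply/cP => //; apply: H; exists w.
Qed.

End GrowthBound.

Definition sharply_mif (R : realType) (G : groupType) : Prop :=
  [/\ finitely_generated G, mixed_identity_free G &
      forall S : set G, finite_set S -> generates S ->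
        exists2 C : R, 0 < C &
          forall n : nat, (2 <= n)%N -> (mif_growth S n)%:R <= C * ln n%:R].

Section Hyperbolic.
Variables (R : realType) (X : metricType R).
Implicit Types (x y z o : X) (u v : nat -> X).

Definition gromov_product o x y : R :=
  (mdist x o + mdist y o - mdist x y) / 2.

Definition gromov_hyperbolic : Prop :=
  exists delta : R, forall o x y z,
    Num.min (gromov_product o x y) (gromov_product o y z) - delta
      <= gromov_product o x z.

Definition converges_to_infinity o u : Prop :=
  forall M : R, exists N : nat, forall m n : nat, (N <= m)%N -> (N <= n)%N ->
    M <= gromov_product o (u m) (u n).

Definition same_limit o u v : Prop :=
  forall M : R, exists N : nat, forall m n : nat, (N <= m)%N -> (N <= n)%N ->
    M <= gromov_product o (u m) (v n).

(* A point of the Gromov boundary of X is an equivalence class of sequences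
   converging to infinity; neither notion depends on the base point o. *)
Definition boundary_point o u : set (nat -> X) :=
  [set v | converges_to_infinity o v /\ same_limit o u v].

End Hyperbolic.

Section Actions.
Local Open Scope card_scope.
Variables (R : realType) (G : groupType) (X : metricType R).
Variable act : G -> X -> X.

Definition isometric_action : Prop :=
  [/\ forall x, act 1%g x = x,
      forall g h x, act (g * h)%g x = act g (act h x) &
      forall g x y, mdist (act g x) (act g y) = mdist x y].

Definition acylindrical : Prop :=
  forall eps : R, 0 < eps -> exists (r : R) (N : nat), 0 < r /\
    forall x y : X, r <= mdist x y ->
      [set g | mdist x (act g x) <= eps /\ mdist y (act g y) <= eps]
        #<= `I_N.

(* The limit points of the orbit of o in the Gromov boundary of X. *)
Definition limit_set (o : X) : set (set (nat -> X)) :=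
  [set boundary_point o u | u in
    [set u | converges_to_infinity o u /\ forall n, exists g, u n = act g o]].

(* The limit set does not depend on o, and an action is elementary when it has
   at most two points. *)
Definition nonelementary : Prop := exists o : X, ~ (limit_set o #<= `I_2).

End Actions.

Definition acylindrically_hyperbolic (R : realType) (G : groupType) : Prop :=
  exists (X : metricType R) (act : G -> X -> X),
    [/\ gromov_hyperbolic X, isometric_action act, acylindrical act &
        nonelementary act].

Section FiniteRadical.
Variable G : groupType.
Local Open Scope group_scope.

Definition finite_normal_subgroup (K : set G) : Prop :=
  [/\ finite_set K, K 1, forall g h, K g -> K h -> K (g * h),
      forall g, K g -> K g^-1 & forall g h, K g -> K (g ^ h)].

Definition maximal_finite_normal_subgroup (K : set G) : Prop :=
  finite_normal_subgroup K /\
  forall L, finite_normal_subgroup L -> K `<=` L -> L = K.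

Definition is_finite_radical (K : set G) : Prop :=
  unique maximal_finite_normal_subgroup K.

End FiniteRadical.

(* Main.v *)
Require Import Defs.
From HB Require Import structures.
From mathcomp Require Import all_boot all_order all_algebra generic_quotient lra zify.
From mathcomp Require Import all_classical all_reals all_analysis.

Set Implicit Arguments.
Unset Strict Implicit.
Unset Printing Implicit Defensive.

Import Order.TTheory GRing.Theory Num.Theory.

Local Open Scope group_scope.
Local Open Scope ring_scope.

(** Fix a base point o of the hyperbolic space and work on G with the pullback
    d(g, h) of the distance between g o and h o; write |g| = d(1, g).

    Three limit points give a loxodromic element f with arbitrarily large |f|
    and small Gromov product of f and f^-1.  Acylindricity shows that, after
    replacing f by a power, an element moving a long segment of the axis of f
    close to this axis satisfies g f g^-1 = f or f^-1; these elements form the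
    stabilizer E of the axis, and translates of the axis by elements outside E
    have bounded coarse intersection.  So words f^(n_0) v_1 f^(n_1) v_2 ... with
    v_i outside E and all |n_i| large trace local, hence global, quasi-geodesics.
    The intersection of the conjugates of E is a finite normal subgroup, hence
    trivial, and finitely many v_i suffice for no nontrivial element to preserve
    all the axes crossed by the marker p = f^D v_1 f^D ... v_r f^D, for all large D.

    Let s and s' run over the 2^L products of L factors f^P b and f^-P b, where
    D is a large multiple of L, and substitute g = q b q'^-1 for x, with q = s p
    and q' = s' p.  A given element of G points towards at most one q, so if 2^L
    exceeds a constant times the number of constants of the mixed word, one can
    choose s and s' such that no constant a points towards q or q', or brings q
    close to q'.  At a junction q^-1 a q with a nontrivial, cancellation would force
    a to preserve all the axes of the marker, so there is none either: the value
    of the mixed word follows a quasi-geodesic and is nontrivial.  The length of g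
    is linear in L, that is, logarithmic in the length of the mixed word. *)

(** * Hyperbolic left-invariant metrics *)

(* Only a pseudometric is required, as base points may have nontrivial stabilizers. *)
Record hyperbolic_group_metric (R : realType) (G : groupType) := HyperbolicGroupMetric {
  dist :> G -> G -> R;
  hypc : R;
  distxx : forall x, dist x x = 0;
  distC : forall x y, dist x y = dist y x;
  distT : forall x y z, dist x z <= dist x y + dist y z;
  distM : forall g x y, dist (g * x)%g (g * y)%g = dist x y;
  hypc_ge0 : 0 <= hypc;
  dist_hyp : forall o x y z,
    Num.min ((dist x o + dist y o - dist x y) / 2) ((dist y o + dist z o - dist y z) / 2) - hypc
      <= (dist x o + dist z o - dist x z) / 2 }.

Section Products.
Variables (R : realType) (G : groupType) (d : hyperbolic_group_metric R G).
Implicit Types (g h o x y z : G).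
Local Notation delta := (hypc d).

Definition gromov_prod o x y : R := (d x o + d y o - d x y) / 2.
Local Notation gp := gromov_prod.

Lemma dist_ge0 x y : 0 <= d x y.
Proof. by have := distT d x y x; rewrite (distC d y x) distxx; lra. Qed.

Lemma gpC o x y : gp o x y = gp o y x.
Proof. by rewrite /gromov_prod (distC d x y); lra. Qed.

Lemma gp_ge0 o x y : 0 <= gp o x y.
Proof. by rewrite /gromov_prod; have := distT d x o y; rewrite (distC d o y); lra. Qed.

Lemma gp_lel o x y : gp o x y <= d o x.
Proof.
by rewrite /gromov_prod; have := distT d y x o; rewrite (distC d y x) (distC d o x); lra.
Qed.

Lemma gp_ler o x y : gp o x y <= d o y.
Proof. by rewrite gpC gp_lel. Qed.

Lemma gpxx o x : gp o x x = d o x.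
Proof. by rewrite /gromov_prod distxx (distC d o x); lra. Qed.

Lemma gpo o x : gp o o x = 0.
Proof. by rewrite /gromov_prod distxx (distC d o x); lra. Qed.

Lemma gp_swap x y z : gp x y z + gp y x z = d x y.
Proof. by rewrite /gromov_prod (distC d y x) (distC d z x) (distC d z y); lra. Qed.

Lemma dist_gp o x y : d x y = d o x + d o y - 2 * gp o x y.
Proof. by rewrite /gromov_prod (distC d o x) (distC d o y); lra. Qed.

Lemma gpM g o x y : gp (g * o)%g (g * x)%g (g * y)%g = gp o x y.
Proof. by rewrite /gromov_prod !distM. Qed.

Lemma distVM g x y : d (g^-1 * x)%g y = d x (g * y)%g.
Proof. by rewrite -(distM d g) mulVKg. Qed.

Lemma dist1V g : d 1%g g^-1%g = d 1%g g.
Proof. by rewrite -(distM d g) mulgV mulg1 distC. Qed.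

Lemma dist1M g h : d 1%g (g * h)%g = d g^-1%g h.
Proof. by rewrite -(distM d g g^-1%g) mulgV. Qed.

Lemma dist_mulr g h : d g (g * h)%g = d 1%g h.
Proof. by rewrite -{1}[g]mulg1 distM. Qed.

(** What [u] and [u * h] share is [u] minus the part that [h] retraces. *)
Lemma gp_step u h : gp 1%g u (u * h)%g = d 1%g u - gp 1%g u^-1%g h.
Proof.
have <- := gp_swap 1%g u (u * h)%g.
by have := gpM u 1%g u^-1%g h; rewrite mulgV mulg1 => ->; rewrite addrK.
Qed.

Lemma len_mul g h : d 1%g (g * h)%g <= d 1%g g + d 1%g h.
Proof. by have := distT d 1%g g (g * h)%g; rewrite dist_mulr. Qed.

Lemma gp_lipr o x y z : gp o x y <= gp o x z + d y z.
Proof.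
rewrite /gromov_prod; have := distT d x y z; have := distT d y z o; rewrite ?(distC d z y); lra.
Qed.

Lemma gp_lipl o x y z : gp o x y <= gp o z y + d x z.
Proof. by rewrite (gpC o x) (gpC o z) gp_lipr. Qed.

Lemma gp_lipo o o' x y : gp o x y <= gp o' x y + d o o'.
Proof.
rewrite /gromov_prod; have := distT d x o' o; have := distT d y o' o; rewrite (distC d o' o); lra.
Qed.

Lemma gp_ge o x y z c : c <= gp o x y -> c <= gp o y z -> c - delta <= gp o x z.
Proof.
move=> cx cz; have : Num.min (gp o x y) (gp o y z) - delta <= gp o x z := dist_hyp d o x y z.
by have : c <= Num.min (gp o x y) (gp o y z); [rewrite le_min cx|lra].
Qed.

(** Points [x] and [y] that stay together beyond [c + delta] are interchangeable when compared with
    [z] at scale [c]. *)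
Lemma gp_le o x y z c : gp o x z <= c -> c + delta < gp o x y -> gp o y z <= c + delta.
Proof.
move=> cz cx; have [//|cy] := (lerP (gp o y z) (c + delta)).
have : Num.min (gp o x y) (gp o y z) - delta <= gp o x z := dist_hyp d o x y z.
by have : c + delta < Num.min (gp o x y) (gp o y z); [rewrite lt_min cx|lra].
Qed.

Lemma four_point x y z w :
  d x y + d z w <= d x z + d y w + 2 * delta \/
  d x y + d z w <= d x w + d y z + 2 * delta.
Proof.
have := dist_hyp d w x z y; rewrite minEle.
have := distC d z w; have := distC d y z; case: ifP => _ e1 e2 e3.
  by left; lra.
by right; lra.
Qed.

(** Seen from [y], the far points [x] and [x'] lie in the same direction, and so do [z] and [z'];
    hence the loss does not depend on [t]. *)
Lemma gp_quad y x z x' z' t c : 0 <= t ->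
  gp y x z <= c -> d x x' <= t -> d z z' <= t ->
  t + c + 2 * delta < d y x -> t + c + 2 * delta < d y z ->
  gp y x' z' <= c + 2 * delta.
Proof.
move=> t0 yc xt zt yx yz; have := hypc_ge0 d => del.
have e1 : gp y x' z <= c + delta.
  apply: (gp_le (x := x)) => //.
  by have := gp_lipr y x x x'; rewrite gpxx; lra.
have e2 : gp y z' x' <= c + delta + delta.
  apply: (gp_le (x := z)); first by rewrite gpC.
  by have := gp_lipr y z z z'; rewrite gpxx; lra.
by rewrite gpC; lra.
Qed.

(** As [d x z] is nearly [d x y + d y z], it cancels the distances to the endpoints in the
    four-point inequality for [y], [a y], [x], [z]. *)
Lemma gp_displacement a x y z t c : gp y x z <= c ->
  d x (a * x)%g <= t -> d z (a * z)%g <= t -> d y (a * y)%g <= t + 2 * c + 2 * delta.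
Proof.
move=> yc xt zt.
have yz := distT d (a * y)%g (a * z)%g z; have yx := distT d (a * y)%g (a * x)%g x.
have xz : d x y + d y z <= d x z + 2 * c by move: yc; rewrite /gromov_prod (distC d z y); lra.
rewrite !distM in yz yx; have xy := distC d x y.
have ax := distC d (a * x)%g x; have az := distC d (a * z)%g z.
case: (four_point y (a * y)%g x z) => ?; lra.
Qed.

(** * Local-to-global principle for chains of long steps with bounded turns *)

Fixpoint word (l : seq G) : G := if l is t :: l' then (t * word l')%g else 1%g.

Lemma word_cat l1 l2 : word (l1 ++ l2) = (word l1 * word l2)%g.
Proof. by elim: l1 => [|t l IH] /=; rewrite ?mul1g // IH mulgA. Qed.

Definition turn (a : R) (t u : G) : bool := gp 1%g t^-1%g u <= a.

Section LocalToGlobal.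
Variable a : R.
Hypothesis a_ge0 : 0 <= a.
Definition long (t : G) : bool := 2 * a + 3 * delta + 1 <= d 1%g t.

(** Induction from the far end: the rest of the chain retraces at most [a + delta] of its first step
    [u], so it points in the direction of [u], which turns away from [t^-1]. *)
Lemma chain_start t l : path (turn a) t l -> all long l -> gp 1%g t^-1%g (word l) <= a + delta.
Proof.
have del := hypc_ge0 d; have a0 := a_ge0.
elim: l t => [|u l IH] t /=; first by move=> _ _; rewrite gpC gpo; lra.
move=> /andP[tu ul] /andP[u1 l1]; rewrite gpC.
have := IH u ul l1; case: l {IH ul l1} => [_|v l vl].
  by rewrite mulg1 gpC; apply: le_trans tu _; lra.
apply: (@gp_le 1%g u); first by rewrite gpC.
by rewrite gp_step; move: u1 vl; rewrite /long; lra.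
Qed.

Lemma word_rev l : word (rev ([seq t^-1%g | t <- l])) = (word l)^-1%g.
Proof.
elim: l => [|t l IH] /=; first by rewrite invg1.
by rewrite rev_cons -cats1 word_cat IH /= mulg1 invgM.
Qed.

Lemma turnV t u : turn a u^-1%g t^-1%g = turn a t u.
Proof. by rewrite /turn invgK gpC. Qed.

Lemma longV t : long t^-1%g = long t.
Proof. by rewrite /long dist1V. Qed.

(* The mirror image of [chain_start], applied to the reversed chain. *)
Lemma chain_end l u : path (turn a) (head 1%g (rcons l u)) (behead (rcons l u)) -> all long l ->
  gp 1%g (word l)^-1%g u <= a + delta.
Proof.
move=> lu ll; rewrite gpC -word_rev -[u]invgK; apply: chain_start; last first.
  by rewrite all_rev all_map; apply: sub_all ll => t; rewrite /= longV.
case: l lu {ll} => //= t l lu.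
rewrite rev_cons; have := lu; rewrite -[path _ _ _]/(sorted (turn a) (t :: rcons l u)).
rewrite -rcons_cons -rev_sorted rev_rcons /= rev_cons => H.
rewrite -map_rev -map_rcons path_map.
by apply: sub_path H => x y /=; rewrite turnV.
Qed.

Lemma chain_middle l1 l2 : sorted (turn a) (l1 ++ l2) -> all long (l1 ++ l2) ->
  gp 1%g (word l1)^-1%g (word l2) <= a + 2 * delta.
Proof.
have del := hypc_ge0 d; have a0 := a_ge0.
case: l2 => [|u l2]; first by rewrite /= gpC gpo; lra.
move=> srt; rewrite all_cat => /andP[l1l /andP[ul l2l]].
have e1 : gp 1%g (word l1)^-1%g u <= a + delta.
  apply: chain_end => //; have : sorted (turn a) (rcons l1 u).
    by move: srt; rewrite -cat_rcons => /cat_sorted2[].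
  by case: (l1).
rewrite gpC; have -> : a + 2 * delta = a + delta + delta by lra.
have /= e2 : gp 1%g u^-1%g (word l2) <= a + delta.
  by apply: chain_start => //; move: srt => /cat_sorted2[].
apply: (@gp_le 1%g u); first by rewrite gpC.
rewrite gp_step; move: ul; rewrite /long /=; lra.
Qed.

End LocalToGlobal.

End Products.

(** * Loxodromic elements and stabilizers of their axes *)

Section Loxodromic.
Variables (R : realType) (G : groupType) (d : hyperbolic_group_metric R G).
Implicit Types (f g h x y z : G) (i j n : nat).
Local Notation delta := (hypc d).
Local Notation gp := (gromov_prod d).

(** The powers of [f] form a quasi-geodesic line: backtracking at [1] is at most [k], and the growth
    is at least linear, normalized to slope one. *)
Definition lox (k : R) f :=
  (forall i j, gp 1%g (f^-1 ^+ i)%g (f ^+ j)%g <= k) /\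
  (forall i, i%:R <= d 1%g (f ^+ i)%g).

Section Lox.
Variables (k : R) (f : G).
Hypothesis fk : lox k f.

Lemma lox_ge0 : 0 <= k.
Proof. by have := fk.1 0%N 0%N; have := gp_ge0 d 1%g (f^-1 ^+ 0)%g (f ^+ 0)%g; lra. Qed.

Lemma lox_inv : lox k f^-1%g.
Proof.
split=> [i j|i]; first by rewrite invgK gpC; exact: fk.1.
by rewrite expVgn dist1V; exact: fk.2.
Qed.

Lemma lox_exp n : (0 < n)%N -> lox k (f ^+ n)%g.
Proof.
move=> n0; split=> [i j|i]; first by rewrite expVgn -!expgnA -expVgn; exact: fk.1.
rewrite -expgnA; apply: le_trans (fk.2 _).
by rewrite ler_nat; nia.
Qed.

Lemma lox_mid i n : (i <= n)%N -> gp (f ^+ i)%g 1%g (f ^+ n)%g <= k.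
Proof.
move=> ni; rewrite -(gpM d (f ^- i)%g) mulVg mulg1 -expVgn.
by rewrite -(subnKC ni) expgnDr mulgA expVgn mulVg mul1g -expVgn; exact: fk.1.
Qed.

Lemma lox_lenD i j :
  d 1%g (f ^+ i)%g + d 1%g (f ^+ j)%g - 2 * k <= d 1%g (f ^+ (i + j))%g.
Proof.
rewrite expgnDr dist1M -expVgn (dist_gp d 1%g (f^-1 ^+ i)%g).
have e : d 1%g (f^-1 ^+ i)%g = d 1%g (f ^+ i)%g by rewrite expVgn dist1V.
by have := fk.1 i j; lra.
Qed.

Lemma lox_gp i n : (i <= n)%N -> d 1%g (f ^+ i)%g - k <= gp 1%g (f ^+ i)%g (f ^+ n)%g.
Proof.
by move=> ni; rewrite -(gp_swap d 1%g (f ^+ i)%g (f ^+ n)%g); have := lox_mid ni; lra.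
Qed.

Lemma len_exp i : d 1%g (f ^+ i)%g <= i%:R * d 1%g f.
Proof.
elim: i => [|i IH]; first by rewrite expg0 distxx mul0r.
rewrite expgS; have := len_mul d f (f ^+ i)%g; rewrite -natr1 mulrDl mul1r; lra.
Qed.

Lemma level n (t : R) : 0 <= t -> exists j, [/\ (j <= n)%N, d 1%g (f ^+ j)%g <= t &
  j = n \/ t <= d 1%g (f ^+ j)%g + d 1%g f].
Proof.
move=> t0; elim: n => [|n [j [jn jt [e|tj]]]].
- by exists 0%N; split; [|rewrite expg0 distxx|left].
- case: (lerP (d 1%g (f ^+ n.+1)%g) t) => tn; first by exists n.+1; split; [|by []|left].
  exists j; split=> //; first exact: leqW.
  by right; subst j; have := len_mul d (f ^+ n)%g f; rewrite -expgSr; lra.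
- by exists j; split=> //; [exact: leqW|right].
Qed.

(** The power [f ^+ j] is chosen at nearly the same distance from [1] as [x]; both are almost on a
    geodesic from [1] to [f ^+ n], so the four-point inequality makes them close. *)
Lemma lox_near x n (K : R) : gp x 1%g (f ^+ n)%g <= K ->
  exists2 j, (j <= n)%N & d x (f ^+ j)%g <= 2 * K + 2 * k + d 1%g f + 2 * delta.
Proof.
move=> xK; have k0 := lox_ge0; have del := hypc_ge0 d; have f0 := dist_ge0 d 1%g f.
have K0 := gp_ge0 d x 1%g (f ^+ n)%g.
have [j [jn jx jt]] := level n (dist_ge0 d 1%g x).
exists j => //.
have e1 : d 1%g x + d x (f ^+ n)%g <= d 1%g (f ^+ n)%g + 2 * K.
  by move: xK; rewrite /gromov_prod (distC d (f ^+ n)%g x); lra.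
have e2 : d 1%g (f ^+ j)%g + d (f ^+ j)%g (f ^+ n)%g <= d 1%g (f ^+ n)%g + 2 * k.
  by have := lox_mid jn; rewrite /gromov_prod (distC d (f ^+ n)%g (f ^+ j)%g); lra.
have e3 : d 1%g x <= d 1%g (f ^+ j)%g + 2 * K + d 1%g f.
  case: jt => [jt|]; last by lra.
  by subst j; have := dist_ge0 d x (f ^+ n)%g; lra.
have := distC d x 1%g; have := distC d (f ^+ j)%g 1%g.
by case: (four_point d x (f ^+ j)%g 1%g (f ^+ n)%g); lra.
Qed.

End Lox.

Lemma word_nseq n f : word (nseq n f) = (f ^+ n)%g.
Proof. by elim: n => //= n ->; rewrite expgS. Qed.

(** All the turns of the chain [f, f, ...] are the same, so the local-to-global principle
    applies. *)
Lemma lox_of_turn f (c : R) : gp 1%g f^-1%g f <= c -> 2 * c + 3 * delta + 1 <= d 1%g f ->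
  lox (c + 2 * delta) f.
Proof.
move=> fc fl; have del := hypc_ge0 d.
have c0 : 0 <= c by apply: le_trans fc; exact: gp_ge0.
have path_nseq n t : t = f -> path (turn d c) t (nseq n f).
  by move=> ->; elim: n => //= n ->; rewrite andbT.
have all_nseq n : all (long d c) (nseq n f) by rewrite all_nseq /long fl orbT.
split=> [i j|i].
  rewrite expVgn -!word_nseq; apply: chain_middle => //; rewrite -nseqD //.
  by case: (i + j)%N => //= n; exact: path_nseq.
elim: i => [|i IH]; first exact: dist_ge0.
rewrite expgS (dist_gp d f).
have -> : gp f 1%g (f * f ^+ i)%g = gp 1%g f^-1%g (f ^+ i)%g.
  by have := gpM d f 1%g f^-1%g (f ^+ i)%g; rewrite mulgV mulg1.
have := @chain_start _ _ d c c0 f (nseq i f) (path_nseq i f erefl) (all_nseq i).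
rewrite word_nseq dist_mulr (distC d f 1%g) -natr1; lra.
Qed.

End Loxodromic.

Lemma exists_nat_ge (R : realType) (r : R) : exists n : nat, r <= n%:R.
Proof.
by exists (Num.bound `|r|); apply: le_trans (ler_norm r) (ltW (archi_boundP (normr_ge0 r))).
Qed.

(** * Acylindricity and pairs of axes *)

Section Acylindrical.
Variables (R : realType) (G : groupType) (d : hyperbolic_group_metric R G).
Implicit Types (f g h x y z : G) (i j n : nat) (s : seq G).
Local Notation delta := (hypc d).
Local Notation gp := (gromov_prod d).

Definition acylindrical_metric := forall e : R, 0 < e -> exists (r : R) (N : nat),
  forall x y, r <= d x y -> forall s, uniq s ->
    (forall k, k \in s -> d x (k * x)%g <= e /\ d y (k * y)%g <= e) -> (size s <= N)%N.

(** The bound of [lox_near] for [K = k + 2 * e], with [l] bounding the length of the loxodromic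
    element. *)
Definition near_const (k l e : R) : R := 2 * (k + 2 * e) + 2 * k + l + 2 * delta.

Lemma lox_dist k f i j : lox d k f ->
  d (f ^+ i)%g (f ^+ j)%g <= `|d 1%g (f ^+ i)%g - d 1%g (f ^+ j)%g| + 2 * k.
Proof.
move=> fk; wlog ij : i j / (i <= j)%N => [H|].
  case/orP: (leq_total i j) => [/H //|/H]; by rewrite distC distrC.
rewrite -(subnKC ij) expgnDr dist_mulr -expgnDr.
have := lox_lenD fk i (j - i).
have := ler_norm (d 1%g (f ^+ (i + (j - i)))%g - d 1%g (f ^+ i)%g).
by rewrite distrC; lra.
Qed.

Section TwoAxes.
Variables (k l : R) (f1 f2 : G).
Hypotheses (f1k : lox d k f1) (f2k : lox d k f2).
Hypotheses (f2l : d 1%g f2 <= l) (f12 : forall i, d 1%g (f1 ^+ i)%g = d 1%g (f2 ^+ i)%g).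

(** [lox_near] gives some [f2 ^+ j] near [g * f1 ^+ i]. Powers of [f1] and [f2] have equal lengths,
    so the exponents [i] and [j] give nearly equal lengths, and [j] can be replaced by [i]. *)
Lemma fellow_travel (e : R) g P Q i : d 1%g g <= e -> d (g * f1 ^+ P)%g (f2 ^+ Q)%g <= e ->
  (i <= P)%N -> d (g * f1 ^+ i)%g (f2 ^+ i)%g <= e + 2 * near_const k l e + 2 * k.
Proof.
move=> ge gPe iP; have := lox_mid f1k iP; rewrite -(gpM d g) mulg1 => mid.
have mid2 : gp (g * f1 ^+ i)%g 1%g (f2 ^+ Q)%g <= k + 2 * e.
  have := gp_lipl d (g * f1 ^+ i)%g 1%g (f2 ^+ Q)%g g.
  have := gp_lipr d (g * f1 ^+ i)%g g (f2 ^+ Q)%g (g * f1 ^+ P)%g.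
  by rewrite (distC d (f2 ^+ Q)%g); lra.
have [j _] := lox_near f2k mid2; rewrite -/(near_const k l e) => near.
have near' : d (g * f1 ^+ i)%g (f2 ^+ j)%g <= near_const k l e.
  by move: near; rewrite /near_const; have := f2l; lra.
have := lox_dist j i f2k.
have t1 := distT d (g * f1 ^+ i)%g (f2 ^+ j)%g (f2 ^+ i)%g.
have t2 := distT d 1%g (g * f1 ^+ i)%g (f2 ^+ j)%g.
have t3 := distT d 1%g g (g * f1 ^+ i)%g.
have t4 := distT d g 1%g (g * f1 ^+ i)%g.
have t5 := distT d 1%g (f2 ^+ j)%g (g * f1 ^+ i)%g.
rewrite dist_mulr f12 in t3 t4.
rewrite (distC d g) in t4; rewrite (distC d (f2 ^+ j)%g (g * _)%g) in t5.
have : `|d 1%g (f2 ^+ j)%g - d 1%g (f2 ^+ i)%g| <= near_const k l e + e.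
  by rewrite ler_norml; apply/andP; split; lra.
lra.
Qed.

End TwoAxes.

Hypothesis d_acyl : acylindrical_metric.

(* The elements [f2^-m g f1^m g^-1] for [m <= N] coarsely fix a long segment of
   the axis of [f2], so two of them agree. *)
Lemma acylindrical_axes (k l e : R) : 0 <= k -> 0 <= l -> 0 <= e -> exists T N : nat,
  forall f1 f2, lox d k f1 -> lox d k f2 -> d 1%g f2 <= l ->
    (forall i, d 1%g (f1 ^+ i)%g = d 1%g (f2 ^+ i)%g) ->
  forall g P Q, d 1%g g <= e -> d (g * f1 ^+ P)%g (f2 ^+ Q)%g <= e -> (T <= P)%N ->
  exists2 m, (0 < m <= N)%N & (g * f1 ^+ m = f2 ^+ m * g)%g.
Proof.
move=> k0 l0 e0; set e2 := e + 2 * near_const k l e + 2 * k.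
have del := hypc_ge0 d.
have e2e : e <= e2 by rewrite /e2 /near_const; lra.
have [|r [N acN]] := d_acyl (e := 2 * e2 + 1); first by lra.
have [I rI] := exists_nat_ge r.
(* The test points [g] and [g * f1 ^+ I] are at distance at least [r]; the extra [N] leaves room to
   shift them along the axis by [m <= N]. *)
exists (I + N)%N, N => f1 f2 f1k f2k f2l f12 g P Q ge gPe TP.
have fel i : (i <= P)%N -> d (g * f1 ^+ i)%g (f2 ^+ i)%g <= e2.
  by move=> iP; exact: (fellow_travel f1k f2k f2l f12 ge gPe iP).
pose F m := (f2 ^- m * (g * f1 ^+ m * g^-1))%g.
have : ~~ uniq (map F (iota 0 N.+1)).
  apply/negP => u; suff : (size (map F (iota 0 N.+1)) <= N)%N.
    by rewrite size_map size_iota ltnn.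
  apply: (acN g (g * f1 ^+ I)%g) => //.
    by rewrite dist_mulr; apply: le_trans rI _; exact: f1k.2.
  move=> _ /mapP[m mN ->]; rewrite mem_iota /= add0n ltnS in mN.
  split.
    rewrite distC /F -!mulgA mulVg mulg1 distVM.
    have := fel m; rewrite (leq_trans _ TP) ?(leq_trans mN) ?leq_addl // => /(_ isT).
    have := distT d (g * f1 ^+ m)%g (f2 ^+ m)%g (f2 ^+ m * g)%g.
    by rewrite dist_mulr; lra.
  rewrite distC /F -!mulgA mulKg distVM.
  have := fel (m + I)%N; rewrite (leq_trans _ TP) 1?addnC ?leq_add2l // => /(_ isT).
  have := fel I; rewrite (leq_trans _ TP) ?leq_addr // => /(_ isT).
  rewrite (addnC I) !expgnDr.
  have := distT d (g * (f1 ^+ m * f1 ^+ I))%g (f2 ^+ m * f2 ^+ I)%g (f2 ^+ m * (g * f1 ^+ I))%g.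
  by rewrite distM (distC d (f2 ^+ I)%g); lra.
case/(uniqPn 1%g) => i [j]; rewrite size_map size_iota => -[ij jN].
rewrite !(nth_map 0%N) ?size_iota ?(ltn_trans ij) // !nth_iota ?(ltn_trans ij) // !add0n /F => Fij.
exists (j - i)%N; first by lia.
set t := (j - i)%N; have ej : j = (t + i)%N by rewrite /t; lia.
have Fij' : (f2 ^- i * (g * f1 ^+ i) = f2 ^- j * (g * f1 ^+ j))%g.
  by apply: (mulIg g^-1%g); rewrite -!mulgA in Fij *.
apply: (mulIg (f1 ^+ i)%g); rewrite -!mulgA -expgnDr -ej.
by rewrite -[LHS](mulVKg (f2 ^+ j)%g) -Fij' ej expgnDr -!mulgA mulVKg.
Qed.

End Acylindrical.

(** * Intertwining relations and the algebraic stabilizer of an axis *)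

Section Intertwine.
Variable G : groupType.
Implicit Types (f g h x y z : G).
Local Open Scope group_scope.

Lemma intertwineX g x y n : g * x = y * g -> g * x ^+ n = y ^+ n * g.
Proof.
move=> gxy; elim: n => [|n IH]; first by rewrite !expg0 mulg1 mul1g.
by rewrite expgSr mulgA IH -mulgA gxy mulgA -expgSr.
Qed.

Lemma conj_eq1 x c : x^-1 * c * x = 1 -> c = 1.
Proof. by move=> e; apply: (mulgI x^-1); apply: (mulIg x); rewrite e mulg1 mulVg. Qed.

Lemma intertwineV g x y : g * x = y * g -> g * x^-1 = y^-1 * g.
Proof. by move=> gxy; apply: (mulIg x); rewrite mulgVK -mulgA gxy mulKg. Qed.

Definition sgn f f1 := f1 = f \/ f1 = f^-1.

Lemma sgnV f f1 : sgn f f1 -> sgn f f1^-1.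
Proof. by case=> ->; [right|left; rewrite invgK]. Qed.

(** The subgroup E in algebraic form; the property [wpd] links it to the geometry of the axis. *)
Definition axis_stab f g := g * f = f * g \/ g * f = f^-1 * g.

Lemma axis_stab_sgn f f1 f2 g : sgn f f1 -> sgn f f2 -> g * f1 = f2 * g -> axis_stab f g.
Proof.
case=> -> [->|->] e; [by left|by right|right|left].
  by rewrite -[f in LHS]invgK; apply/intertwineV.
by rewrite -[f]invgK; apply/intertwineV.
Qed.

Lemma axis_stabP f g : axis_stab f g <-> exists2 f1, sgn f f1 & g * f = f1 * g.
Proof.
split=> [[]e|[f1 [->|->]]]; [|by exists f^-1; [right|]|by left|by right].
by exists f; [left|].
Qed.

Lemma axis_stabM f g h : axis_stab f g -> axis_stab f h -> axis_stab f (g * h).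
Proof.
move=> /axis_stabP[f1 f1s gf] [] hf.
  by apply/axis_stabP; exists f1; rewrite // -mulgA hf !mulgA gf.
apply/axis_stabP; exists f1^-1; first exact: sgnV.
by rewrite -mulgA hf !mulgA (intertwineV gf).
Qed.

Lemma axis_stabV f g : axis_stab f g -> axis_stab f g^-1.
Proof.
move=> [] gf; [left|right]; apply: (mulgI g); rewrite ?mulVKg mulgA.
  by rewrite gf -mulgA mulgV mulg1.
by rewrite (intertwineV gf) invgK -mulgA mulgV mulg1.
Qed.

Lemma axis_stab1 f : axis_stab f 1.
Proof. by left; rewrite mulg1 mul1g. Qed.

Lemma axis_stabX f n : axis_stab f (f ^+ n).
Proof. by left; rewrite -expgSr expgS. Qed.

End Intertwine.

Section AxisStabilizer.
Variables (R : realType) (G : groupType) (d : hyperbolic_group_metric R G).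
Implicit Types (f g h x y z : G) (i j n : nat).
Local Notation delta := (hypc d).
Local Notation gp := (gromov_prod d).

Lemma lox_sgn k f f1 : lox d k f -> sgn f f1 -> lox d k f1.
Proof. by move=> fk [->|->] //; exact: lox_inv. Qed.

Lemma len_sgn f f1 i : sgn f f1 -> d 1%g (f1 ^+ i)%g = d 1%g (f ^+ i)%g.
Proof. by case=> -> //; rewrite expVgn dist1V. Qed.

Definition axis_const (k l : R) : R := 2 * (k + 2 * delta) + 2 * k + l + 2 * delta.

(** The far points [g * f1 ^+ n] and [g * f1 ^- n] equal [f2 ^+ n * g] and [f2 ^- n * g], within
    [d 1 g] of the axis of [f2]; by [gp_quad] the points between are close to it with a bound
    independent of [g]. *)
Lemma intertwine_near k f1 f2 g m I : lox d k f1 -> lox d k f2 -> (0 < m)%N ->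
  (g * f1 ^+ m = f2 ^+ m * g)%g ->
  exists n, forall i, (i <= I)%N ->
    exists j, d (g * f1 ^+ i)%g (f2 ^- n * f2 ^+ j)%g <= axis_const k (d 1%g f2).
Proof.
move=> f1k f2k m0 gf; have del := hypc_ge0 d; have k0 := lox_ge0 f1k.
have [c cI] := exists_nat_ge (I%:R + d 1%g g + k + 2 * delta + 1).
pose n := (m * c)%N.
have gfn : (g * f1 ^+ n = f2 ^+ n * g)%g by rewrite !expgnA; exact: intertwineX.
have gfVn : (g * f1 ^- n = f2 ^- n * g)%g by exact: intertwineV.
have cn : c%:R <= n%:R :> R by rewrite ler_nat /n; nia.
exists n => i iI; set y := (g * f1 ^+ i)%g.
have iI' : i%:R <= I%:R :> R by rewrite ler_nat.
have len_g := dist_ge0 d 1%g g.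
have nin : (i <= n)%N by rewrite -(ler_nat R); lra.
have y1 : gp y (g * f1 ^- n)%g (g * f1 ^+ n)%g <= k.
  rewrite gpM -(gpM d (f1 ^+ i)^-1%g) mulVg.
  have -> : ((f1 ^+ i)^-1 * f1 ^+ n = f1 ^+ (n - i))%g by rewrite -{1}(subnKC nin) expgnDr mulKg.
  by rewrite -invgM -expgnDr -expVgn; exact: f1k.1.
have y2 : gp y (f2 ^- n)%g (f2 ^+ n)%g <= k + 2 * delta.
  apply: (gp_quad (t := d 1%g g)) y1 _ _ _ _; first by [].
  - by rewrite gfVn distC dist_mulr.
  - by rewrite gfn distC dist_mulr.
  - rewrite /y distM (distC d (f1 ^+ i)%g) -(distM d (f1 ^+ n)%g (f1 ^- n)%g) mulgV -expgnDr.
    by have := f1k.2 (n + i)%N; rewrite natrD; have := ler0n R i; lra.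
  - rewrite /y distM -{1}(subnKC nin) expgnDr dist_mulr.
    by have := f1k.2 (n - i)%N; rewrite natrB //; lra.
rewrite -(gpM d (f2 ^+ n)%g) mulgV -expgnDr in y2.
have [j _ yj] := lox_near f2k y2.
by exists j; rewrite distC distVM distC.
Qed.

Hypothesis d_acyl : acylindrical_metric d.

(** A strong form of the WPD property: a long coarse coincidence of the axis with its translate, in
    either direction, forces [g] into the stabilizer. *)
Definition wpd f := forall e : R, 0 <= e -> exists T : nat, forall f1 f2, sgn f f1 -> sgn f f2 ->
  forall g P Q, d 1%g g <= e -> d (g * f1 ^+ P)%g (f2 ^+ Q)%g <= e -> (T <= P)%N ->
  axis_stab f g.

(* The exponents produced by [acylindrical_axes] at the scale [axis_const]
   are bounded, so that one power of [f] is normalized by all elements that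
   intertwine some powers of [f]. *)
Lemma wpd_power k f : lox d k f -> exists2 f0, lox d k f0 & wpd f0.
Proof.
move=> fk; have del := hypc_ge0 d; have k0 := lox_ge0 fk; have l0 := dist_ge0 d 1%g f.
set e := axis_const k (d 1%g f).
have e0 : 0 <= e by rewrite /e /axis_const; lra.
have [T [N TN]] := acylindrical_axes d_acyl k0 l0 e0.
pose f0 := (f ^+ N`!)%g; have f0k : lox d k f0 by apply: lox_exp => //; exact: fact_gt0.
have sgnX f1 n : sgn f f1 -> sgn (f ^+ n)%g (f1 ^+ n)%g.
  by case=> ->; [left|right; rewrite expVgn].
have key f1 f2 g m : sgn f f1 -> sgn f f2 -> (0 < m)%N -> (g * f1 ^+ m = f2 ^+ m * g)%g ->
    axis_stab f0 g.
  move=> s1 s2 m0 gf; have f1k := lox_sgn fk s1; have f2k := lox_sgn fk s2.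
  have [n nH] := intertwine_near T f1k f2k m0 gf.
  have l2 : d 1%g f2 = d 1%g f by exact: (len_sgn 1 s2).
  have [j0] := nH 0%N isT; have [j1] := nH T (leqnn T); rewrite l2 -/e expg0 mulg1 => n1 n0.
  (* Translating [g] along the axis of [f2] gives an element of length at most [e], whatever [g]
     is. *)
  pose h := (f2 ^- j0 * f2 ^+ n * g)%g.
  have he : d 1%g h <= e.
    rewrite /h -mulgA -(distM d (f2 ^+ j0)%g) mulVKg mulg1 -(distM d (f2 ^- n)%g).
    by rewrite mulKg distC.
  have hT : d (h * f1 ^+ T)%g (f2 ^- j0 * f2 ^+ j1)%g <= e.
    by rewrite /h -!mulgA distM -(distM d (f2 ^- n)%g) mulKg.
  have [f3 [Q [s3 f3Q]]] : exists f3 Q, sgn f2 f3 /\ (f2 ^- j0 * f2 ^+ j1 = f3 ^+ Q)%g.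
    case/orP: (leq_total j0 j1) => jj.
      by exists f2, (j1 - j0)%N; split; [left|rewrite -{1}(subnKC jj) expgnDr mulKg].
    exists f2^-1%g, (j0 - j1)%N; split; [by right|].
    by rewrite -{1}(subnKC jj) expgnDr invgM mulgVK expVgn.
  have s3f : sgn f f3 by case: s3 => ->; [exact: s2|exact: sgnV].
  rewrite f3Q in hT.
  have [||m' /andP[m'0 m'N] hm'] := TN f1 f3 f1k (lox_sgn fk s3f) _ _ h T Q he hT (leqnn T).
  - by rewrite (len_sgn 1 s3f).
  - by move=> i; rewrite (len_sgn _ s1) (len_sgn _ s3f).
  have gm' : (g * f1 ^+ m' = f3 ^+ m' * g)%g.
    (* Powers of [f2] and [f3] commute, so the relation found for [h] descends to [g]. *)
    have c3 p : commute (f3 ^+ m')%g (f2 ^+ p)%g.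
      by case: s3 => ->; rewrite ?expVgn; [|apply/commute_sym/commuteV]; apply: commuteX2.
    apply: (mulgI (f2 ^- j0 * f2 ^+ n)%g); rewrite !mulgA -/h hm' /h !mulgA.
    have := c3 n; have := commuteV (c3 j0); rewrite /commute => -> /esym e1.
    by rewrite -!mulgA (mulgA (f2 ^+ n)%g) e1 !mulgA.
  have /dvdnP[c Nc] : (m' %| N`!)%N by rewrite dvdn_fact // m'0.
  apply: (@axis_stab_sgn _ f0 (f1 ^+ N`!)%g (f3 ^+ N`!)%g); [exact: sgnX|exact: sgnX|].
  by rewrite Nc mulnC !expgnA; exact: intertwineX.
exists f0 => // e' e'0.
have [T' [N' T'N']] := acylindrical_axes d_acyl k0 (dist_ge0 d 1%g f0) e'0.
exists T' => f1 f2 s1 s2 g P Q ge gPe TP.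
have [||m /andP[m0 _] gm] := T'N' f1 f2 (lox_sgn f0k s1) (lox_sgn f0k s2) _ _ g P Q ge gPe TP.
- by rewrite (len_sgn 1 s2).
- by move=> i; rewrite (len_sgn _ s1) (len_sgn _ s2).
have ex fi : sgn f0 fi -> exists2 fi', sgn f fi' & fi = (fi' ^+ N`!)%g.
  case=> ->; first by exists f; [left|].
  by exists f^-1%g; [right|rewrite expVgn].
have [f1' s1' e1] := ex _ s1; have [f2' s2' e2] := ex _ s2.
apply: (key f1' f2' g (N`! * m)%N) => //; first by rewrite muln_gt0 fact_gt0.
by rewrite !expgnA -e1 -e2.
Qed.

End AxisStabilizer.

(** * Loxodromic elements from three directions, and smallness of the stabilizer *)

Section Stabilizers.
Variables (R : realType) (G : groupType) (d : hyperbolic_group_metric R G).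
Implicit Types (f g h v x y z a : G) (i j n : nat) (s : seq G).
Local Notation delta := (hypc d).
Local Notation gp := (gromov_prod d).

(** Three limit points without limits: [C] is fixed while the elements are arbitrarily far. *)
Definition three_directions := exists C : R, forall r : R, exists g h k,
  [/\ r <= d 1%g g, r <= d 1%g h & r <= d 1%g k] /\
  [/\ gp 1%g g h <= C, gp 1%g g k <= C & gp 1%g h k <= C].

(* If neither [g] nor [h] is loxodromic, then [g^-1] and [h^-1] point in the
   directions of [g] and [h] respectively, so [g h^-1] does not backtrack. *)
Lemma exists_lox : three_directions -> exists k f, lox d k f.
Proof.
move=> [C CH]; have del := hypc_ge0 d.
pose c := C + 2 * delta; have [g [h [_ [[g1 h1 _] [gh _ _]]]]] := CH (4 * c + 5 * delta + C + 2).
have C0 : 0 <= C by apply: le_trans gh; exact: gp_ge0.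
exists (c + 2 * delta).
case: (lerP (gp 1%g g^-1%g g) c) => gg.
  by exists g; apply: lox_of_turn => //; move: g1; rewrite /c; lra.
case: (lerP (gp 1%g h^-1%g h) c) => hh.
  by exists h; apply: lox_of_turn => //; move: h1; rewrite /c; lra.
have gVh : gp 1%g g^-1%g h <= C + delta.
  by apply: (gp_le gh); move: gg; rewrite gpC /c; lra.
have gVhV : gp 1%g g^-1%g h^-1%g <= c.
  rewrite gpC; have := @gp_le _ _ d 1%g h h^-1%g g^-1%g (C + delta); rewrite gpC /c => H.
  have : gp 1%g h^-1%g g^-1%g <= C + delta + delta; last by lra.
  by apply: H => //; rewrite gpC; move: hh; rewrite /c; lra.
have fg : C + 2 * delta < gp 1%g g (g * h^-1)%g.
  by rewrite gp_step; move: g1; rewrite /c in gVhV *; lra.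
have fh : C + 2 * delta < gp 1%g h (h * g^-1)%g.
  by rewrite gp_step gpC; move: h1; rewrite /c in gVhV *; lra.
exists (g * h^-1)%g; apply: lox_of_turn.
  rewrite invgM invgK.
  have e1 : gp 1%g (g * h^-1)%g h <= C + delta by apply: (gp_le gh); lra.
  have : gp 1%g (h * g^-1)%g (g * h^-1)%g <= C + delta + delta.
    by apply: (@gp_le _ _ d 1%g h); [rewrite gpC|lra].
  by rewrite /c; lra.
rewrite dist1M (dist_gp d 1%g) !dist1V; move: g1 h1; rewrite /c in gVhV *; lra.
Qed.

Section Axis.
Variables (k : R) (f : G).
Hypotheses (fk : lox d k f).
Let B := axis_const d k (d 1%g f).

Lemma axis_const_ge0 : 0 <= B.
Proof.
have := lox_ge0 fk; have := dist_ge0 d 1%g f; have := hypc_ge0 d.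
by rewrite /B /axis_const; lra.
Qed.

Lemma axis_stab_near g : axis_stab f g -> exists f1 i, sgn f f1 /\ d g (f1 ^+ i)%g <= B.
Proof.
move=> /axis_stabP[f1 s1 gf].
have := @intertwine_near _ _ d k f f1 g 1 0 fk (lox_sgn fk s1) isT.
rewrite !expg1 => /(_ gf) [n /(_ 0%N isT) [j]].
rewrite expg0 mulg1 (len_sgn d 1 s1) expg1 -/B => gB.
case/orP: (leq_total n j) => nj.
  by exists f1, (j - n)%N; split=> //; move: gB; rewrite -{1}(subnKC nj) expgnDr mulKg.
exists f1^-1%g, (n - j)%N; split; first exact: sgnV.
by move: gB; rewrite -{1}(subnKC nj) expgnDr invgM mulgVK expVgn.
Qed.

(** Otherwise the whole group is close to the axis, which has only two ends, and two of three far
    elements point to the same end. *)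
Lemma exists_not_axis_stab : three_directions -> exists b, ~ axis_stab f b.
Proof.
move=> [C CH]; apply: contrapT => nob.
have all_stab g : axis_stab f g by apply: contrapT => ng; apply: nob; exists g.
have B0 := axis_const_ge0.
have [g [h [m [[g1 h1 m1] [gh gm hm]]]]] := CH (C + k + 3 * B + 1).
have same f1 x y i j : sgn f f1 -> C + k + 3 * B + 1 <= d 1%g x -> C + k + 3 * B + 1 <= d 1%g y ->
    d x (f1 ^+ i)%g <= B -> d y (f1 ^+ j)%g <= B -> C < gp 1%g x y.
  wlog ij : x y i j / (i <= j)%N => [H|] s1 x1 y1 xi yj.
    by case/orP: (leq_total i j) => ij; [|rewrite gpC]; apply: H ij s1 _ _ _ _.
  have := lox_gp (lox_sgn fk s1) ij.
  have := gp_lipl d 1%g (f1 ^+ i)%g (f1 ^+ j)%g x; have := gp_lipr d 1%g x (f1 ^+ j)%g y.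
  have := distT d 1%g (f1 ^+ i)%g x; rewrite !(distC d (f1 ^+ _)%g); lra.
have [f1 [i [s1 gi]]] := axis_stab_near (all_stab g).
have [f2 [j [s2 hj]]] := axis_stab_near (all_stab h).
have [f3 [l [s3 ml]]] := axis_stab_near (all_stab m).
have [e|[e|e]] : f1 = f2 \/ f1 = f3 \/ f2 = f3.
  by case: s1 => ->; case: s2 => ->; case: s3 => ->; auto.
- by subst f2; have := same _ _ _ _ _ s1 g1 h1 gi hj; lra.
- by subst f3; have := same _ _ _ _ _ s1 g1 m1 gi ml; lra.
- by subst f3; have := same _ _ _ _ _ s2 h1 m1 hj ml; lra.
Qed.

(** If the product were large, the axis and its translate by [v] would run together for long, and
    [wpd] would put [v] in the stabilizer. *)
Lemma axis_gp_bound v : wpd d f -> ~ axis_stab f v ->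
  exists K : R, forall f1 f2 P Q, sgn f f1 -> sgn f f2 -> gp 1%g (f1 ^+ P)%g (v * f2 ^+ Q)%g <= K.
Proof.
move=> fw nv; have del := hypc_ge0 d; have k0 := lox_ge0 fk; have l0 := dist_ge0 d 1%g f.
have v0 := dist_ge0 d 1%g v.
set l := d 1%g f in l0.
pose e := 3 * d 1%g v + 2 * l + 2 * k + 4 * delta.
have e0 : 0 <= e by rewrite /e; lra.
have [T TH] := fw _ e0.
exists (T%:R * l + l + d 1%g v) => f1 f2 P Q s1 s2.
have f1k := lox_sgn fk s1; have f2k := lox_sgn fk s2.
case: lerP => // tK; exfalso; apply: nv.
set t := gp _ _ _ in tK; pose t' := t - d 1%g v.
have tP : t <= d 1%g (f1 ^+ P)%g by exact: gp_lel.
have tQ : t' <= d 1%g (f2 ^+ Q)%g.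
  have := gp_ler d 1%g (f1 ^+ P)%g (v * f2 ^+ Q)%g.
  by have := len_mul d v (f2 ^+ Q)%g; rewrite /t' -/t; lra.
have T0 : 0 <= T%:R * l by rewrite mulr_ge0.
have t'0 : 0 <= t' by rewrite /t'; lra.
have l1 : d 1%g f1 = l by have := len_sgn d 1 s1.
have l2 : d 1%g f2 = l by have := len_sgn d 1 s2.
have [i [iP it ti]] := level d f1 P t'0; rewrite l1 in ti.
have [j [jQ jt tj]] := level d f2 Q t'0; rewrite l2 in tj.
have ti' : t' <= d 1%g (f1 ^+ i)%g + l by case: ti => // e1; rewrite e1 /t'; lra.
have tj' : t' <= d 1%g (f2 ^+ j)%g + l by case: tj => // e1; rewrite e1; lra.
have g1 := lox_gp f1k iP; have g2 := lox_gp f2k jQ.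
have g3 : t' - l - k - d 1%g v <= gp 1%g (v * f2 ^+ Q)%g (v * f2 ^+ j)%g.
  have := gpM d v 1%g (f2 ^+ j)%g (f2 ^+ Q)%g; rewrite mulg1 gpC => g3.
  by have := gp_lipo d v 1%g (v * f2 ^+ Q)%g (v * f2 ^+ j)%g; rewrite (distC d v); lra.
have g4 : t' - l - k - d 1%g v - delta - delta <= gp 1%g (f1 ^+ i)%g (v * f2 ^+ j)%g.
  apply: (gp_ge (y := (v * f2 ^+ Q)%g)); last by lra.
  by apply: (gp_ge (y := (f1 ^+ P)%g)); rewrite -/t; [|rewrite /t']; lra.
have dij : d (v * f2 ^+ j)%g (f1 ^+ i)%g <= e.
  rewrite distC (dist_gp d 1%g); have := len_mul d v (f2 ^+ j)%g.
  by rewrite /e; lra.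
apply: (TH f2 f1 s2 s1 v j i) => //; first by rewrite /e; lra.
rewrite leqNgt; apply/negP => jT.
have := len_exp d f2 j; rewrite l2.
have : j%:R * l <= T%:R * l by rewrite ler_wpM2r // ler_nat ltnW.
by rewrite /t' in tj'; lra.
Qed.

(** Such an [a] is close both to the axis and to its translate by [v], whose common part is bounded
    by [axis_gp_bound]. *)
Lemma axis_stab_conj_bound v : wpd d f -> ~ axis_stab f v ->
  exists C : R, forall a, axis_stab f a -> axis_stab f (v^-1 * a * v)%g -> d 1%g a <= C.
Proof.
move=> fw nv; have [K KH] := axis_gp_bound fw nv.
exists (K + 2 * B + d 1%g v) => a.
move=> /axis_stab_near[f1 [i [s1 ai]]] /axis_stab_near[f2 [j [s2 aj]]].
have a2 : d a (v * f2 ^+ j)%g <= B + d 1%g v.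
  move: aj; rewrite -mulgA distVM; have := distT d a (a * v)%g (v * f2 ^+ j)%g.
  by rewrite dist_mulr; lra.
rewrite -(gpxx d); have := KH _ _ i j s1 s2.
have := gp_lipr d 1%g a a (v * f2 ^+ j)%g.
by have := gp_lipl d 1%g a (v * f2 ^+ j)%g (f1 ^+ i)%g; lra.
Qed.

Hypothesis d_acyl : acylindrical_metric d.

(** An element commuting with [f] displaces [f ^+ I] as much as [1], so acylindricity bounds their
    number. Elements inverting [f] become commuting ones after division by one of them, hence the
    radius [2 * C]. *)
Lemma axis_stab_ball_finite (C : R) : exists N, forall s, uniq s ->
  (forall a, a \in s -> axis_stab f a /\ d 1%g a <= C) -> (size s <= N)%N.
Proof.
have [|r [N rN]] := d_acyl (e := 2 * `|C| + 1); first by have := normr_ge0 C; lra.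
have [I rI] := exists_nat_ge r.
have C1 := ler_norm C; have C0 := normr_ge0 C.
have comm s : uniq s -> (forall a, a \in s -> (a * f = f * a)%g /\ d 1%g a <= 2 * C) ->
    (size s <= N)%N.
  move=> us sH; apply: (rN 1%g (f ^+ I)%g _ s us); first by apply: le_trans rI (fk.2 I).
  move=> a /sH[af aC]; rewrite mulg1.
  by rewrite (intertwineX I af) dist_mulr; split; lra.
exists (N + N)%N => s us sH.
pose p a := `[< (a * f = f * a)%g >].
rewrite -(count_predC p) leq_add // -size_filter.
  apply: comm; first exact: filter_uniq.
  move=> a; rewrite mem_filter => /andP[/asboolP af /sH[_ aC]]; split=> //.
  by have := dist_ge0 d 1%g a; lra.
have sH' a : a \in [seq x <- s | ~~ p x] -> (a * f = f^-1 * a)%g /\ d 1%g a <= C.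
  by rewrite mem_filter /= => /andP[/asboolP np /sH[[]]].
have := filter_uniq (predC p) us; rewrite -[seq.filter _ _]/[seq x <- s | ~~ p x].
move: sH'; case: [seq x <- s | ~~ p x] => [//|a0 t] sH' ut.
rewrite -(size_map (fun a => a0^-1 * a)%g); apply: comm.
  by rewrite map_inj_uniq // => x y /mulgI.
move=> _ /mapP[a /sH'[af aC] ->].
have [a0f a0C] := sH' a0 (mem_head _ _); split; last first.
  by have := len_mul d a0^-1%g a; rewrite dist1V; lra.
by rewrite -mulgA af; apply: (mulgI a0); rewrite !mulgA mulgV mul1g a0f mulgK.
Qed.

End Axis.

End Stabilizers.

(** * Markers *)

Section Marker.
Variables (R : realType) (G : groupType) (d : hyperbolic_group_metric R G).
Implicit Types (f g h v x y z a : G) (i j n : nat) (s : seq G).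

Lemma finite_set_uniq_seq (A : set G) N :
  (forall s, uniq s -> (forall a, a \in s -> A a) -> (size s <= N)%N) -> finite_set A.
Proof.
move=> AN; apply: contrapT => /(infinite_set_fset N.+1)[X XA XN].
have := AN (finmap.enum_fset X) (finmap.fset_uniq X) (fun a aX => XA a aX).
by move=> XN'; have := leq_trans XN XN'; rewrite ltnn.
Qed.

Variables (k : R) (f : G).
Hypotheses (fk : lox d k f) (fw : wpd d f) (d_acyl : acylindrical_metric d).

(** The intersection [K] of the conjugates of the stabilizer is normal, and finite since it lies in
    the stabilizer and in its conjugate by [b]. *)
Lemma exists_moved_axis b : ~ axis_stab f b ->
  (forall K : set G, finite_normal_subgroup K -> K = [set 1%g]%classic) ->
  forall a, a <> 1%g -> exists h, ~ axis_stab f (h^-1 * a * h)%g.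
Proof.
move=> nb triv a a1; apply: contrapT => noh.
pose K := [set x | forall h, axis_stab f (h^-1 * x * h)%g]%classic.
have Ka : K a by move=> h; apply: contrapT => nh; apply: noh; exists h.
have [C CH] := axis_stab_conj_bound fk fw nb.
have [N NH] := axis_stab_ball_finite fk d_acyl C.
have K1 x : K x -> axis_stab f x by move=> /(_ 1%g); rewrite invg1 mul1g mulg1.
suff KE : K = [set 1%g]%classic by apply: a1; move: Ka; rewrite KE.
apply: triv; split.
- apply: (@finite_set_uniq_seq _ N) => s us sK; apply: NH => // x /sK Kx.
  by split; [exact: K1|apply: CH; [exact: K1|exact: Kx]].
- by move=> h; rewrite mulg1 mulVg; exact: axis_stab1.
- move=> x y Kx Ky h.
  have -> : (h^-1 * (x * y) * h = (h^-1 * x * h) * (h^-1 * y * h))%g.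
    by rewrite !mulgA mulgK.
  exact: axis_stabM.
- move=> x Kx h; have -> : (h^-1 * x^-1 * h = (h^-1 * x * h)^-1)%g.
    by rewrite !invgM invgK mulgA.
  exact: axis_stabV.
- move=> x y Kx h; rewrite conjgE.
  have -> : (h^-1 * (y^-1 * (x * y)) * h = (y * h)^-1 * x * (y * h))%g.
    by rewrite invgM !mulgA.
  exact: Kx.
Qed.

(* The axes are the translates of the axis of [f] by [1], [f^D v_1],
   [f^D v_1 f^D v_2], and so on. *)
Fixpoint preserves_axes D (vs : seq G) a : Prop :=
  axis_stab f a /\
  if vs is v :: vs' then preserves_axes D vs' ((f ^+ D * v)^-1 * a * (f ^+ D * v))%g else True.

Lemma preserves_axes_stab D vs a : preserves_axes D vs a -> axis_stab f a.
Proof. by case: vs => [|v vs] []. Qed.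

Lemma preserves_axes_rcons vs v a : preserves_axes 0 (rcons vs v) a <->
  preserves_axes 0 vs a /\ axis_stab f ((word vs * v)^-1 * a * (word vs * v))%g.
Proof.
elim: vs a => [|w vs IH] a /=; first by rewrite !expg0 !mul1g; tauto.
rewrite IH expg0 mul1g.
have -> : ((word vs * v)^-1 * (w^-1 * a * w) * (word vs * v) =
  (w * word vs * v)^-1 * a * (w * word vs * v))%g by rewrite !invgM !mulgA.
by tauto.
Qed.

Lemma preserves_axes_last vs a : preserves_axes 0 vs a ->
  axis_stab f ((word vs)^-1 * a * word vs)%g.
Proof.
elim: vs a => [|w vs IH] a /=; first by case; rewrite invg1 mul1g mulg1.
by rewrite expg0 mul1g => -[_ /IH]; rewrite invgM !mulgA.
Qed.

Hypothesis moved : forall a, a <> 1%g -> exists h, ~ axis_stab f (h^-1 * a * h)%g.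

(* Each element added to the list excludes an element that preserved all the
   previous axes. *)
Lemma exists_seq_marker b : ~ axis_stab f b ->
  exists vs, [/\ vs <> [::], forall v, v \in vs -> ~ axis_stab f v &
    forall a, preserves_axes 0 vs a -> a = 1%g].
Proof.
move=> nb; have [C CH] := axis_stab_conj_bound fk fw nb.
have [N NH] := axis_stab_ball_finite fk d_acyl C.
(* Here [n] bounds the number of nontrivial elements preserving all the axes; the list [[:: b]]
   already makes this number finite. *)
suff H n vs : vs <> [::] -> (forall v, v \in vs -> ~ axis_stab f v) ->
    (forall s, uniq s -> (forall a, a \in s -> preserves_axes 0 vs a /\ a <> 1%g) ->
      (size s <= n)%N) ->
    exists vs, [/\ vs <> [::], forall v, v \in vs -> ~ axis_stab f v &
      forall a, preserves_axes 0 vs a -> a = 1%g].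
  apply: (H N [:: b]) => //; first by move=> v; rewrite inE => /eqP ->.
  move=> s us sH; apply: NH => // a /sH[/= ]; rewrite expg0 mul1g => -[sa [sb _]] _.
  by split=> //; exact: CH.
elim: n vs => [|n IH] vs vs0 vsH sn.
  exists vs; split=> // a va; apply: contrapT => a1.
  suff : (size [:: a] <= 0)%N by [].
  by apply: sn => // x; rewrite inE => /eqP ->.
have [[a [va a1]]|none] := pselect (exists a, preserves_axes 0 vs a /\ a <> 1%g); last first.
  by exists vs; split=> // a va; apply: contrapT => a1; apply: none; exists a.
have b1 : ((word vs)^-1 * a * word vs)%g <> 1%g.
  move=> e; apply: a1; apply: (mulgI (word vs)^-1%g); apply: (mulIg (word vs)).
  by rewrite e mulg1 mulVg.
have [h hH] := moved b1.
apply: (IH (rcons vs h)).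
- by case: (vs).
- move=> v; rewrite mem_rcons inE => /orP[/eqP -> hs|/vsH //].
  apply: hH; apply: axis_stabM => //; apply: axis_stabM; first exact: axis_stabV.
  exact: preserves_axes_last.
- move=> s us sH; rewrite -ltnS; apply: (sn (a :: s)).
    rewrite /= us andbT; apply/negP => /sH[/preserves_axes_rcons[_ ah] _].
    by apply: hH; move: ah; rewrite invgM !mulgA.
  move=> x; rewrite inE => /orP[/eqP -> //|/sH[/preserves_axes_rcons[? _] ?]]; by [].
Qed.

(* An element of the stabilizer of the axis that inverts [f] cannot both
   preserve the previous axis and, after conjugation by a large power of [f],
   the next one. *)
Lemma preserves_axes_large v vs : (forall w, w \in v :: vs -> ~ axis_stab f w) ->
  exists D0, forall D, (D0 <= D)%N -> forall a,
    preserves_axes D (v :: vs) a -> preserves_axes 0 (v :: vs) (f ^- D * a * f ^+ D)%g.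
Proof.
have stabJ D a : axis_stab f a -> axis_stab f (f ^- D * a * f ^+ D)%g.
  by move=> sa; apply: axis_stabM; [apply: axis_stabM => //; apply: axis_stabV|]; exact: axis_stabX.
have conjE D v' a : ((f ^+ D * v')^-1 * a * (f ^+ D * v') =
  v'^-1 * (f ^- D * a * f ^+ D) * v')%g by rewrite invgM !mulgA.
elim: vs v => [|w vs IH] v vH.
  exists 0%N => D _ a /= [sa [sv _]]; split; first exact: stabJ.
  by split=> //; rewrite expg0 mul1g -conjE.
have [D1 D1H] := IH w (fun u uw => vH u (@mem_behead _ (v :: w :: vs) u uw)).
have [C1 C1H] := axis_stab_conj_bound fk fw (vH v (mem_head _ _)).
have [C2 C2H] := axis_stab_conj_bound fk fw (vH w (@mem_behead _ (v :: w :: vs) w (mem_head _ _))).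
(* The length of [a1] is at most [C1 + 2 * d 1 v]; if [a1] inverts [f], its conjugate is
   [f ^- (D + D) * a1], which is longer than [C2] for [D >= D2]. *)
have [D2 D2H] := exists_nat_ge (C1 + 2 * d 1%g v + C2 + 1).
exists (maxn D1 D2) => D; rewrite geq_max => /andP[DD1 DD2] a.
rewrite /preserves_axes -!/preserves_axes => -[sa]; rewrite conjE.
set a0 := (f ^- D * a * f ^+ D)%g; set a1 := (v^-1 * a0 * v)%g => pa1.
split; first exact: stabJ.
rewrite expg0 mul1g -/a1.
suff <- : (f ^- D * a1 * f ^+ D = a1)%g by exact: (D1H D DD1 a1 pa1).
have sa1 : axis_stab f a1 := pa1.1.
have l1 : d 1%g a1 <= C1 + 2 * d 1%g v.
  have := C1H a0 (stabJ _ _ sa) sa1.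
  have := len_mul d (v^-1 * a0)%g v; have := len_mul d v^-1%g a0.
  by rewrite dist1V -/a1; lra.
case: (sa1) => fa1; first by rewrite -mulgA (intertwineX D fa1) mulKg.
exfalso; have := C2H (f ^- D * a1 * f ^+ D)%g (stabJ _ _ sa1).
have sw : axis_stab f (w^-1 * (f ^- D * a1 * f ^+ D) * w)%g.
  by move: pa1 => /= [_ /preserves_axes_stab]; rewrite conjE.
move=> /(_ sw); rewrite -mulgA (intertwineX D fa1) expVgn mulgA -invgM -expgnDr.
have := len_mul d (f ^- (D + D) * a1)%g a1^-1%g; rewrite mulgK !dist1V.
have := fk.2 (D + D)%N; rewrite natrD.
have : D2%:R <= D%:R :> R by rewrite ler_nat.
have := ler0n R D; lra.
Qed.

Lemma exists_marker b : ~ axis_stab f b -> exists (vs : seq G) D0,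
  (forall v, v \in vs -> ~ axis_stab f v) /\
  forall D, (D0 <= D)%N -> forall a, preserves_axes D vs a -> a = 1%g.
Proof.
move=> /exists_seq_marker[[|v vs] [// _ vH v1]].
have [D0 D0H] := preserves_axes_large vH; exists (v :: vs), D0; split=> // D DD a /D0H-/(_ DD)/v1 e.
apply: (mulgI (f ^- D)%g); apply: (mulIg (f ^+ D)%g); rewrite e mulg1 mulVg //.
Qed.

End Marker.

(** * Quasi-geodesic words ending with a marker *)

Section Segments.
Variables (R : realType) (G : groupType) (d : hyperbolic_group_metric R G).
Implicit Types (f g h v w x y z a : G) (i j n D : nat) (s : seq bool).
Local Notation delta := (hypc d).
Local Notation gp := (gromov_prod d).

Variables (k : R) (f : G).
Hypotheses (fk : lox d k f) (fw : wpd d f).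

(* Near the middle of a long segment of the axis, an element that displaces its
   endpoints by [t] is at distance at most [axis_const] from the axis, whatever
   [t] is. *)
Lemma long_segment_stab : exists2 C : R, 0 <= C & forall (t : R) D a, 0 <= t -> 2 * t + C <= D%:R ->
  d 1%g a <= t -> d (f ^+ D)%g (a * f ^+ D)%g <= t -> axis_stab f a.
Proof.
have del := hypc_ge0 d; have k0 := lox_ge0 fk; have l0 := dist_ge0 d 1%g f.
pose e := axis_const d k (d 1%g f).
have e0 : 0 <= e by rewrite /e /axis_const; lra.
have [T TH] := fw e0.
exists (T%:R + 2 * (k + 2 * delta + 1) + 1) => [|t D a t0 tD at1 atD].
  by have := ler0n R T; lra.
(* Deeper than [c] inside the segment, [gp_quad] absorbs the displacement [t]; a window of [T]
   exponents from [i1] on is thus close to the axis. *)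
pose c := t + k + 2 * delta + 1.
pose i1 := (Num.truncn c).+1.
have c0 : 0 <= c by rewrite /c; lra.
have i1l : c < i1%:R by exact: truncnS_gt.
have i1u : i1%:R <= c + 1 by rewrite /i1 -natr1 lerD2r truncn_le.
have iD : (i1 + T <= D)%N by rewrite -(ler_nat R) natrD; move: i1u; rewrite /c; lra.
have near i : (i1 <= i)%N -> (i <= i1 + T)%N -> exists j, d (a * f ^+ i)%g (f ^+ j)%g <= e.
  move=> ii iT; have iD' := leq_trans iT iD.
  have := lox_mid fk iD'; rewrite -(gpM d a) mulg1 => mid.
  have ci : c < i%:R by apply: (lt_le_trans i1l); rewrite ler_nat.
  have mid2 : gp (a * f ^+ i)%g 1%g (f ^+ D)%g <= k + 2 * delta.
    apply: (gp_quad t0 mid).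
    - by rewrite distC.
    - by rewrite distC.
    - rewrite -{2}[a]mulg1 distM distC.
      by have := fk.2 i; rewrite /c in ci; lra.
    - rewrite distM -{1}(subnKC iD') expgnDr dist_mulr.
      have := fk.2 (D - i)%N; rewrite natrB //.
      have : i%:R <= i1%:R + T%:R :> R by rewrite -natrD ler_nat.
      by move: i1u; rewrite /c; lra.
  by have [j _ aj] := lox_near fk mid2; exists j.
have [j1 n1] := near i1 (leqnn _) (leq_addr _ _).
have [j2 n2] := near (i1 + T)%N (leq_addr _ _) (leqnn _).
(* Sliding along the axis turns [a] into an element of length at most [e], so that [wpd] is used at
   a fixed scale. *)
pose h := (f ^- j1 * (a * f ^+ i1))%g.
have [f3 [Q [s3 f3Q]]] : exists f3 Q, sgn f f3 /\ (f ^- j1 * f ^+ j2 = f3 ^+ Q)%g.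
  case/orP: (leq_total j1 j2) => jj.
    by exists f, (j2 - j1)%N; split; [left|rewrite -{1}(subnKC jj) expgnDr mulKg].
  exists f^-1%g, (j1 - j2)%N; split; [by right|].
  by rewrite -{1}(subnKC jj) expgnDr invgM mulgVK expVgn.
have hs : axis_stab f h.
  apply: (TH f f3 _ s3 h T Q) => //; first by left.
    by rewrite distC /h distVM mulg1.
  by rewrite /h -f3Q -!mulgA distM -expgnDr.
have -> : a = (f ^+ j1 * h * (f ^+ i1)^-1)%g by rewrite /h mulVKg mulgK.
apply: axis_stabM; last by apply: axis_stabV; exact: axis_stabX.
by apply: axis_stabM => //; exact: axis_stabX.
Qed.

Section Family.
Variables (b : G) (vs W : seq G) (K lam : R) (P D : nat).
(** The turn bound: [K] for two axes, plus [lam] for the letter ending the inverse of a step. *)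
Let a := K + lam.
Hypotheses (lam_ge0 : 0 <= lam) (bW : b \in W) (vsW : {subset vs <= W}).
Hypothesis W_gp : forall w, w \in W -> forall f1 f2 i j, sgn f f1 -> sgn f f2 ->
  gp 1%g (f1 ^+ i)%g (w * f2 ^+ j)%g <= K.
Hypothesis W_len : forall w, w \in W -> d 1%g w <= lam.
Hypotheses (P_large : lam + 2 * a + 3 * delta + k + 1 <= P%:R) (PD : (P <= D)%N).

Lemma gp_bound_ge0 : 0 <= K.
Proof.
have /= H := W_gp bW 0 0 (or_introl erefl) (or_introl erefl).
by apply: le_trans H; exact: gp_ge0.
Qed.

Lemma turn_bound_ge0 : 0 <= a.
Proof. by rewrite /a; have := lam_ge0; have := gp_bound_ge0; lra. Qed.

(** A letter is grouped with the long power after it, so that [W_gp] controls the turns. *)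
Definition good_step (V : pred G) t := exists w f1 i,
  [/\ w \in V, sgn f f1, (P <= i)%N & t = (w * f1 ^+ i)%g].

Let V1 : pred G := [pred w | (w == 1%g) || (w \in W)].

Lemma V1_len w : w \in V1 -> d 1%g w <= lam.
Proof. by rewrite inE => /orP[/eqP ->|/W_len//]; rewrite distxx; exact: lam_ge0. Qed.

Lemma good_step_start t : good_step (mem W) t -> good_step V1 t.
Proof. by move=> [w [f1 [i [wW ? ? ?]]]]; exists w, f1, i; split=> //; rewrite inE wW orbT. Qed.

Lemma good_step_long t : good_step V1 t -> long d a t.
Proof.
move=> [w [f1 [i [wV s1 Pi ->]]]]; rewrite /long.
have := len_mul d w^-1%g (w * f1 ^+ i)%g; rewrite mulKg dist1V.
have := V1_len wV; have := (lox_sgn fk s1).2 i.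
have : P%:R <= i%:R :> R by rewrite ler_nat.
by have := P_large; have := lox_ge0 fk; lra.
Qed.

Lemma good_step_turn t u : good_step V1 t -> good_step (mem W) u -> turn d a t u.
Proof.
move=> [w [f1 [i [wV s1 Pi ->]]]] [w' [f2 [j [wW s2 Pj ->]]]]; rewrite /turn.
have := W_gp wW i j (sgnV s1) s2; have := V1_len wV.
have := gp_lipl d 1%g (w * f1 ^+ i)^-1%g (w' * f2 ^+ j)%g (f1^-1 ^+ i)%g.
by rewrite invgM expVgn distC dist_mulr dist1V /a; lra.
Qed.

Lemma good_chain t l : good_step V1 t -> (forall u, u \in l -> good_step (mem W) u) ->
  path (turn d a) t l /\ all (long d a) (t :: l).
Proof.
elim: l t => [|u l IH] t tV lW; first by rewrite /= good_step_long.
have uW := lW u (mem_head _ _).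
have [|p al] := IH u (good_step_start uW).
  by move=> x xl; apply: lW; rewrite inE xl orbT.
by rewrite /= good_step_turn // p good_step_long.
Qed.

Definition sgn_power (e : bool) : G := (if e then f ^+ P else f^-1 ^+ P)%g.

Lemma len_sgn_power e : d 1%g (sgn_power e) = d 1%g (f ^+ P)%g.
Proof. by rewrite /sgn_power; case: e => //; rewrite expVgn dist1V. Qed.

(* The steps of the chain visit the points reached after each power of [f];
   the factor [w] is the letter preceding the first power. *)
Fixpoint head_steps w s : seq G :=
  if s is e :: s' then (w * sgn_power e)%g :: head_steps b s' else [::].

Definition tail_steps (l : seq G) : seq G := [seq (v * f ^+ D)%g | v <- l].

Fixpoint random_word s : G := (if s is e :: s' then sgn_power e * b * random_word s' else 1)%g.

Definition marked_word s : G := (random_word s * (f ^+ D * word (tail_steps vs)))%g.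

Lemma good_sgn_power (V : pred G) w e : w \in V -> good_step V (w * sgn_power e)%g.
Proof.
rewrite /sgn_power; case: e => wV; [exists w, f, P|exists w, f^-1%g, P]; split=> //.
  by left.
by right.
Qed.

Lemma good_head w s u : w \in W -> u \in head_steps w s -> good_step (mem W) u.
Proof.
elim: s w => //= e s IH w wW; rewrite inE => /orP[/eqP ->|]; first exact: good_sgn_power.
exact: IH.
Qed.

Lemma good_tail l u : {subset l <= W} -> u \in tail_steps l -> good_step (mem W) u.
Proof. by move=> lW /mapP[v /lW vW ->]; exists v, f, D; split=> //; left. Qed.

Lemma word_head w s : (word (head_steps w s) * (if s is [::] then w else b) = w * random_word s)%g.
Proof.
elim: s w => [|e s IH] w /=; first by rewrite mul1g mulg1.
rewrite -!mulgA; congr (_ * (_ * _))%g; rewrite -IH; case: (s) => //.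
Qed.

Lemma word_headE e s : random_word (e :: s) = (word (head_steps 1%g (e :: s)) * b)%g.
Proof. by have := word_head 1%g (e :: s); rewrite mul1g => <-. Qed.

Definition marked_word_steps e s : seq G :=
  head_steps 1%g (e :: s) ++ (b * f ^+ D)%g :: tail_steps vs.

Lemma marked_word_stepsE e s : marked_word (e :: s) = word (marked_word_steps e s).
Proof. by rewrite /marked_word word_headE word_cat /= !mulgA. Qed.

Lemma marked_word_good e s : good_step V1 (head 1%g (marked_word_steps e s)) /\
  (forall u, u \in behead (marked_word_steps e s) -> good_step (mem W) u).
Proof.
rewrite /marked_word_steps /=; split; first by apply: good_sgn_power; rewrite inE eqxx.
move=> u; rewrite mem_cat inE => /orP[/(good_head bW) //|/orP[/eqP ->|/(good_tail vsW)//]].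
by exists b, f, D; split=> //; left.
Qed.

Lemma marked_word_chain e s :
  sorted (turn d a) (marked_word_steps e s) /\ all (long d a) (marked_word_steps e s).
Proof. by have [g1 g2] := marked_word_good e s; exact: (good_chain g1 g2). Qed.

Let kap := a + 2 * delta + lam.

Lemma mid_shift x w g : w \in W -> gp x 1%g g <= a + 2 * delta -> gp (x * w)%g 1%g g <= kap.
Proof.
move=> wW xg; have := gp_lipo d (x * w)%g x 1%g g; rewrite (distC d _ x) dist_mulr.
by have := W_len wW; rewrite /kap; lra.
Qed.

Lemma word_middle l1 l2 : sorted (turn d a) (l1 ++ l2) -> all (long d a) (l1 ++ l2) ->
  gp (word l1) 1%g (word (l1 ++ l2)) <= a + 2 * delta.
Proof.
move=> s l; rewrite -(gpM d (word l1)^-1%g) mulVg mulg1 word_cat mulKg.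
exact: (chain_middle turn_bound_ge0 s l).
Qed.

(** The path passes near the end of the first factor [f ^+ D], of which only the random prefix can
    cancel a part. *)
Lemma marked_word_len e s :
  d 1%g (f ^+ D)%g - d 1%g (random_word (e :: s)) - 2 * kap <= d 1%g (marked_word (e :: s)).
Proof.
have [c1 c2] := marked_word_chain e s.
have e1 : marked_word_steps e s = (rcons (head_steps 1 (e :: s)) (b * f ^+ D)%g) ++ tail_steps vs.
  by rewrite cat_rcons.
rewrite e1 in c1 c2; have := word_middle c1 c2; rewrite -e1 -marked_word_stepsE.
have -> : word (rcons (head_steps 1 (e :: s)) (b * f ^+ D)%g) = (random_word (e :: s) * f ^+ D)%g.
  by rewrite -cats1 word_cat word_headE [word [:: _]]/= mulg1 mulgA.
set x := random_word (e :: s); set q := marked_word (e :: s) => mid.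
rewrite (dist_gp d (x * f ^+ D)%g 1%g q).
have := len_mul d x^-1%g (x * f ^+ D)%g; rewrite mulKg dist1V.
have := dist_ge0 d (x * f ^+ D)%g q; rewrite (distC d (x * f ^+ D)%g 1%g).
by have := lam_ge0; rewrite /kap; lra.
Qed.

(** The last step is some [w * f ^+ D], so the way back from the end first follows [f ^- D]. *)
Lemma marked_word_end e s :
  d 1%g (f ^+ D)%g - kap <= gp 1%g (marked_word (e :: s))^-1%g (f ^- D)%g.
Proof.
have [l1 [w [wW eq]]] : exists l1 w, w \in W /\ marked_word_steps e s = rcons l1 (w * f ^+ D)%g.
  rewrite /marked_word_steps; case: (lastP vs) vsW => [|l v] lW.
    by exists (head_steps 1 (e :: s)), b; rewrite cats1.
  exists (head_steps 1 (e :: s) ++ (b * f ^+ D)%g :: tail_steps l), v; split.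
    by apply: lW; rewrite mem_rcons mem_head.
  by rewrite /tail_steps map_rcons -rcons_cons -rcons_cat.
have [c1 c2] := marked_word_chain e s; rewrite eq -cats1 in c1 c2.
have mid := mid_shift wW (word_middle c1 c2).
rewrite marked_word_stepsE eq -cats1 word_cat /= mulg1; rewrite word_cat /= mulg1 mulgA in mid.
set x := (word l1 * w)%g in mid; rewrite mulgA -/x.
have := gpM d (x * f ^+ D)%g 1%g (x * f ^+ D)^-1%g (f ^- D)%g.
rewrite mulg1 mulgV mulgK => <-.
have := gp_swap d (x * f ^+ D)%g x 1%g; rewrite distC dist_mulr gpC (gpC d x) => <-.
by rewrite (gpC d x) in mid *; lra.
Qed.

Lemma gp_large_step e s :
  d 1%g (f ^+ P)%g - a - delta <= gp 1%g (sgn_power e) (marked_word (e :: s)).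
Proof.
have [c1 c2] := marked_word_chain e s.
rewrite marked_word_stepsE; move: c1 c2; rewrite /marked_word_steps /= mul1g => c1 /andP[_ c2].
rewrite gp_step; have := chain_start turn_bound_ge0 c1 c2.
rewrite len_sgn_power.
by lra.
Qed.

(** Each common factor costs at most [d 1 (f ^+ P) + d 1 b]; at the first differing sign the words
    leave along opposite powers of [f], whose product is at most [k]. *)
Lemma marked_word_sep s s' : size s = size s' -> s <> s' ->
  gp 1%g (marked_word s) (marked_word s') <=
    (size s)%:R * (d 1%g (f ^+ P)%g + d 1%g b) + k + 2 * delta.
Proof.
have del := hypc_ge0 d; have k0 := lox_ge0 fk.
have beta0 := addr_ge0 (dist_ge0 d 1%g (f ^+ P)%g) (dist_ge0 d 1%g b).
elim: s s' => [|e s IH] [|e' s'] //= [ss'] nss'.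
have n0 : 0 <= (size s)%:R * (d 1%g (f ^+ P)%g + d 1%g b) by rewrite mulr_ge0.
have [ee|/eqP nee] := eqVneq e e'.
  subst e'; have nss : s <> s' by move=> e1; apply: nss'; rewrite e1.
  have := IH s' ss' nss.
  have fE t : marked_word (e :: t) = (sgn_power e * b * marked_word t)%g.
    by rewrite /marked_word /= !mulgA.
  rewrite !fE; have := gp_lipo d 1%g (sgn_power e * b)%g
    (sgn_power e * b * marked_word s)%g (sgn_power e * b * marked_word s')%g.
  have := gpM d (sgn_power e * b)%g 1%g (marked_word s) (marked_word s'); rewrite mulg1 => ->.
  have := len_mul d (sgn_power e) b.
  rewrite len_sgn_power.
  by rewrite -natr1 mulrDl mul1r; lra.
have e1 := gp_large_step e s; have e2 := gp_large_step e' s'.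
have e3 : gp 1%g (sgn_power e) (sgn_power e') <= k.
  rewrite /sgn_power; case: (e) nee; case: (e') => // _; first by rewrite gpC; exact: fk.1.
  exact: fk.1.
have PP := fk.2 P; have Pl := P_large; have a0 := turn_bound_ge0; have l0 := lam_ge0.
have e4 : gp 1%g (marked_word (e :: s)) (sgn_power e') <= k + delta.
  by apply: (gp_le e3); lra.
have : gp 1%g (marked_word (e' :: s')) (marked_word (e :: s)) <= k + delta + delta.
  by apply: (@gp_le _ _ d 1%g (sgn_power e')); [rewrite gpC|lra].
by rewrite gpC -natr1 mulrDl mul1r; lra.
Qed.

(* The marker at the end of [marked_word s] crosses axes that no nontrivial element
   preserves simultaneously. *)
Lemma marked_word_fixed C e s c (t : R) :
  (forall (t : R) D a, 0 <= t -> 2 * t + C <= D%:R ->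
     d 1%g a <= t -> d (f ^+ D)%g (a * f ^+ D)%g <= t -> axis_stab f a) ->
  (forall c, preserves_axes f D vs c -> c = 1%g) ->
  0 <= t -> 2 * (t + 2 * kap + 2 * delta) + C <= D%:R ->
  d 1%g c <= t -> d (marked_word (e :: s)) (c * marked_word (e :: s))%g <= t -> c = 1%g.
Proof.
move=> segH vsH t0 tD c1 cq; set q := marked_word (e :: s) in cq.
have del := hypc_ge0 d; have a0 := turn_bound_ge0; have l0 := lam_ge0.
have c1' : d 1%g (c * 1)%g <= t by rewrite mulg1.
(* Since [1] and [q] move by at most [t], points almost on a geodesic between them, such as both
   ends of each factor [f ^+ D], move by little more. *)
have disp y : gp y 1%g q <= kap -> d y (c * y)%g <= t + 2 * kap + 2 * delta.
  by move=> yq; exact: (gp_displacement yq c1' cq).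
have [ch1 ch2] := marked_word_chain e s.
have disp2 z : gp z 1%g q <= kap -> gp (z * f ^+ D)%g 1%g q <= kap ->
    axis_stab f (z^-1 * c * z)%g.
  move=> z1 z2; apply: (segH (t + 2 * kap + 2 * delta) D) => //; first by rewrite /kap; lra.
    by rewrite -(distM d z 1%g) mulg1 !mulgA mulgV mul1g; exact: disp.
  by rewrite -(distM d z) !mulgA mulgV mul1g -(mulgA c z); exact: disp.
have stab l vs2 w : w \in W -> marked_word_steps e s = l ++ (w * f ^+ D)%g :: tail_steps vs2 ->
    axis_stab f ((word l * w)^-1 * c * (word l * w))%g.
  move=> wW eq; have mid1 := ch1; have mid2 := ch2; rewrite eq in mid1 mid2.
  have m1 := mid_shift wW (word_middle mid1 mid2).
  rewrite -cat_rcons in mid1 mid2; have m2 := word_middle mid1 mid2.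
  rewrite cat_rcons -eq -marked_word_stepsE -cats1 word_cat [word [:: _]]/= mulg1 mulgA in m2.
  rewrite -eq -marked_word_stepsE in m1.
  have m3 : gp (word l * w * f ^+ D)%g 1%g q <= kap by rewrite /kap; move: m2; rewrite -/q; lra.
  exact: disp2.
have main l vs2 w : w \in W -> {subset vs2 <= W} ->
    marked_word_steps e s = l ++ (w * f ^+ D)%g :: tail_steps vs2 ->
    preserves_axes f D vs2 ((word l * w)^-1 * c * (word l * w))%g.
  elim: vs2 l w => [|v vs2 IH] l w wW vW eq; first by split; [exact: stab eq|].
  split; first exact: stab eq.
  have := IH (rcons l (w * f ^+ D)%g) v; rewrite -cats1 word_cat [word [:: _]]/= mulg1.
  have -> : (word l * (w * f ^+ D) * v = word l * w * (f ^+ D * v))%g by rewrite !mulgA.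
  rewrite (invgM _ (f ^+ D * v)%g) !mulgA; apply; last by rewrite eq -!catA.
    by apply: vW; exact: mem_head.
  by move=> u uv; apply: vW; rewrite inE uv orbT.
apply: (@conj_eq1 _ (random_word (e :: s))); apply: vsH.
by rewrite word_headE; exact: (main _ vs b).
Qed.

End Family.
End Segments.

Lemma avoid_unique (T : finType) (I : eqType) (bad : I -> T -> Prop) (ys : seq I) (X : {set T}) :
  (forall y s s', bad y s -> bad y s' -> s = s') -> (size ys < #|X|)%N ->
  exists2 s, s \in X & forall y, y \in ys -> ~ bad y s.
Proof.
move=> uni; elim: ys X => [|y ys IH] X sX.
  by have /card_gt0P[s sX'] := sX; exists s.
have [[s0 bs0]|nb] := pselect (exists s, bad y s); last first.
  have [|s sX' sH] := IH X; first exact: ltnW.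
  exists s => // z; rewrite inE => /orP[/eqP -> bz|/sH //]; by apply: nb; exists s.
have [|s] := IH (X :\ s0)%SET.
  by move: sX; rewrite (cardsD1 s0 X) /=; case: (s0 \in X) => //=; lia.
rewrite !inE => /andP[/eqP ns sX'] sH; exists s => // z; rewrite inE => /orP[/eqP ->|/sH //].
by move=> bs; apply: ns; exact: uni bs bs0.
Qed.

(** * Substitution in mixed words *)

Section Substitution.
Variables (R : realType) (G : groupType) (d : hyperbolic_group_metric R G).
Implicit Types (f g h v w x y z a c : G) (s : seq bool) (l : seq (bool * G)) (e : bool).
Local Notation delta := (hypc d).
Local Notation gp := (gromov_prod d).

Fixpoint mixed_value g l : G :=
  (if l is p :: l' then (if p.1 then g else g^-1) * p.2 * mixed_value g l' else 1)%g.

(** It fails exactly for a cancelling pattern, where the constant of [p] between a variable and its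
    inverse is [1]. *)
Definition reduced_pair (p p' : bool * G) := (p.1 == p'.1) || (p.2 != 1%g).

Variables (L : nat) (q : seq bool -> G) (b F : G) (sigma K lam : R).
(** [a2] bounds the turns of the final chain, [theta] is a product with [F] that ensures them, [jun]
    adds the loss due to [b], and [tau] bounds the displacement in a cancellation. *)
Let a2 := K + 2 * delta.
Let theta := lam + 2 * a2 + 3 * delta + 1.
Let jun := theta + lam.
Let tau := 2 * sigma + 2 * jun + 4 * delta.
Hypotheses (K_ge0 : 0 <= K) (lam_ge0 : 0 <= lam) (sigma_ge0 : 0 <= sigma).
Hypothesis q_end : forall s, size s = L -> jun + delta <= gp 1%g (q s)^-1%g F.
Hypothesis q_sep : forall s s', size s = L -> size s' = L -> s <> s' ->
  gp 1%g (q s) (q s') <= sigma - delta.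
Hypothesis q_len : forall s, size s = L -> tau < d 1%g (q s).
Hypothesis q_fixed : forall s c, size s = L ->
  d 1%g c <= tau -> d (q s) (c * q s)%g <= tau -> c = 1%g.
Hypotheses (bF : gp 1%g F (b * F)%g <= K) (bVF : gp 1%g F (b^-1 * F)%g <= K)
  (b_len : d 1%g b <= lam).

Definition towards y s := sigma < gp 1%g y (q s).

Lemma towards_unique y s s' : size s = L -> size s' = L ->
  towards y s -> towards y s' -> s = s'.
Proof.
rewrite /towards => sL s'L ys ys'; have [//|/eqP nss] := eqVneq s s'.
exfalso; have {nss} e1 := q_sep sL s'L nss.
have : gp 1%g y (q s') <= sigma - delta + delta.
  by apply: (gp_le e1); rewrite gpC; lra.
by lra.
Qed.

(** First [s] avoids at most [size Y] words, then [s'] avoids those excluded by [Y] and by its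
    translates by [q s]. *)
Lemma choose_pair (Y : seq G) : (2 * size Y < 2 ^ L)%N ->
  exists s s', [/\ size s = L, size s' = L &
    forall y, y \in Y -> [/\ ~ towards y s, ~ towards y s' & ~ towards (y * q s)%g s']].
Proof.
move=> YL.
pose bad y (t : L.-tuple bool) := towards y t.
have uni y (t t' : L.-tuple bool) : bad y t -> bad y t' -> t = t'.
  by move=> b1 b2; apply: val_inj; apply: towards_unique b1 b2; rewrite size_tuple.
have cT : #|[set: L.-tuple bool]| = (2 ^ L)%N by rewrite cardsT card_tuple card_bool.
have [|t _ tH] := @avoid_unique _ _ bad Y [set: L.-tuple bool]%SET uni.
  by rewrite cT; apply: leq_ltn_trans YL; rewrite mul2n -addnn leq_addr.
pose Y' := Y ++ [seq (y * q t)%g | y <- Y].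
have [|t' _ t'H] := @avoid_unique _ _ bad Y' [set: L.-tuple bool]%SET uni.
  by rewrite cT /Y' size_cat size_map; move: YL; rewrite mul2n -addnn.
exists t, t'; rewrite !size_tuple; split=> // y yY; split.
- exact: tH.
- by apply: t'H; rewrite /Y' mem_cat yY.
- by apply: t'H; rewrite /Y' mem_cat (map_f (fun y => y * q t)%g) ?orbT.
Qed.

Lemma tau_ge : [/\ 0 <= jun, 2 * sigma + 2 * jun + 4 * delta <= tau & 0 <= a2].
Proof.
have := hypc_ge0 d; have := K_ge0; have := lam_ge0; have := sigma_ge0.
by rewrite /tau /jun /theta /a2; split; lra.
Qed.

(** As [q s] is long, [a * h] leaves most of it uncancelled, so the product sets out along
    [(q s)^-1], that is, along [F]. *)
Lemma junction_separated s a h : size s = L -> gp 1%g (q s) (a * h)%g <= 2 * sigma ->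
  jun <= gp 1%g ((q s)^-1 * (a * h))%g F.
Proof.
move=> sL sh; have del := hypc_ge0 d; have := tau_ge => -[th0 ta a20].
have := q_len sL => ql.
have e1 : jun + delta <= gp 1%g ((q s)^-1 * (a * h))%g (q s)^-1%g.
  have := gp_swap d 1%g (q s) (a * h)%g.
  have := gpM d (q s) 1%g ((q s)^-1 * (a * h))%g (q s)^-1%g.
  by rewrite mulg1 mulVKg mulgV => <-; rewrite (gpC d (q s)); lra.
by have := gp_ge e1 (q_end sL); lra.
Qed.

(* If [a] moves [q s] beyond [q s] itself, then [a] moves both endpoints of the
   segment from [1] to [q s] by at most [tau]. *)
Lemma junction_same s a : size s = L -> a <> 1%g -> ~ towards a s ->
  jun <= gp 1%g ((q s)^-1 * (a * q s))%g F.
Proof.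
move=> sL a1 /negP; rewrite -leNgt => ts; have del := hypc_ge0 d; have := tau_ge => -[th0 ta a20].
have ql := q_len sL; have s0 := sigma_ge0.
have sw := gp_swap d 1%g (q s) (a * q s)%g.
case: (lerP (jun + delta) (gp (q s) 1%g (a * q s)%g)) => e1.
  have e2 : jun + delta <= gp 1%g ((q s)^-1 * (a * q s))%g (q s)^-1%g.
    have := gpM d (q s) 1%g ((q s)^-1 * (a * q s))%g (q s)^-1%g.
    by rewrite mulg1 mulVKg mulgV => <-; rewrite (gpC d (q s)); lra.
  by have := gp_ge e2 (q_end sL); lra.
exfalso; apply: a1; apply: (q_fixed sL).
  have sw' := gp_swap d 1%g (q s) a.
  have e2 : gp (q s) a (a * q s)%g <= jun + delta + delta.
    apply: (@gp_le _ _ d (q s) 1%g); first by lra.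
    by rewrite (gpC d 1%g a) in ts; lra.
  have := dist_gp d (q s) a (a * q s)%g; rewrite dist_mulr.
  have := dist_gp d 1%g (q s) a; have := dist_ge0 d (q s) (a * q s)%g.
  by rewrite (gpC d 1%g a) in ts; lra.
have sw' := gp_swap d 1%g (q s) a.
have e2 : gp (q s) a (a * q s)%g <= jun + delta + delta.
  apply: (@gp_le _ _ d (q s) 1%g); first by lra.
  by rewrite (gpC d 1%g a) in ts; lra.
have := dist_gp d (q s) a (a * q s)%g; rewrite dist_mulr.
have := dist_gp d 1%g (q s) a; have := dist_ge0 d 1%g a.
by rewrite (gpC d 1%g a) in ts; lra.
Qed.

(** The two assumptions bound [d (q s) (y * q s')] below by the sum of the lengths of [y], [q s] and
    [q s'] minus [4 * sigma]. *)
Lemma towards_swap s s' y : ~ towards y s -> ~ towards (y^-1 * q s)%g s' ->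
  gp 1%g (q s) (y * q s')%g <= 2 * sigma.
Proof.
move=> /negP; rewrite -leNgt => ys /negP; rewrite -leNgt => ys'.
rewrite /gromov_prod !(distC d _ 1%g) -(distVM d y (q s)).
have := dist_gp d 1%g (y^-1 * q s)%g (q s'); have := dist1M d y^-1%g (q s).
have := dist_gp d 1%g y (q s); have := len_mul d y (q s').
by rewrite invgK; lra.
Qed.

Lemma reduced_pairV (x y : bool) a :
  (~~ x == ~~ y) || (a^-1%g != 1%g) = (y == x) || (a != 1%g).
Proof. by rewrite invg_eq1; case: x; case: y. Qed.

Section Chain.
Variables (s s' : seq bool).
Hypotheses (sL : size s = L) (s'L : size s' = L).
Let qe e := q (if e then s else s').
Let be e := (if e then b else b^-1)%g.
Let g := (q s * b * (q s')^-1)%g.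

Lemma qe_size e : size (if e then s else s') = L.
Proof. by case: e. Qed.

Definition leaves_well t := exists e h, t = (be e * h)%g /\ theta <= gp 1%g h F.

(** Both [t^-1] and [h] follow [F], while [b] and [b^-1] move [F] to a different direction. *)
Lemma turn_leaves t u : theta <= gp 1%g t^-1%g F -> leaves_well u -> turn d a2 t u.
Proof.
move=> tF [e [h [-> hF]]]; rewrite /turn.
have del := hypc_ge0 d; have k0 := K_ge0; have l0 := lam_ge0.
have be_len : d 1%g (be e) <= lam by rewrite /be; case: (e); rewrite ?dist1V; exact: b_len.
have beF : gp 1%g F (be e * F)%g <= K by rewrite /be; case: (e).
have e1 : theta - lam <= gp 1%g (be e * F)%g (be e * h)%g.
  have := gpM d (be e) 1%g F h; rewrite mulg1 (gpC d 1%g F) => e1.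
  by have := gp_lipo d (be e) 1%g (be e * F)%g (be e * h)%g; rewrite (distC d (be e)); lra.
have e2 : gp 1%g (be e * h)%g F <= K + delta.
  by apply: (@gp_le _ _ d 1%g (be e * F)%g); [rewrite gpC|move: e1; rewrite /theta /a2; lra].
rewrite gpC /a2; have -> : K + 2 * delta = K + delta + delta by lra.
rewrite gpC; apply: (@gp_le _ _ d 1%g F); first by rewrite gpC.
by rewrite gpC; move: tF; rewrite /theta /a2; lra.
Qed.

Lemma long_leaves u : leaves_well u -> long d a2 u.
Proof.
move=> [e [h [-> hF]]]; rewrite /long.
have be_len : d 1%g (be e) <= lam by rewrite /be; case: (e); rewrite ?dist1V; exact: b_len.
have := len_mul d (be e)^-1%g (be e * h)%g; rewrite mulKg dist1V.
by have := gp_lel d 1%g h F; move: hF; rewrite /theta; lra.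
Qed.

(** The word is cut before each middle letter [b] or [b^-1] of the substituted element; the initial
    [qe e] and the last constant are left out. *)
Fixpoint chain_steps e a l : seq G :=
  if l is p :: l' then
    (be e * ((qe (~~ e))^-1 * (a * qe p.1)))%g :: chain_steps p.1 p.2 l'
  else [:: be e * (qe (~~ e))^-1]%g.

Definition good_constant a := [/\ ~ towards a s, ~ towards a s',
  ~ towards (a * q s)%g s' & gp 1%g (q s) (a * q s')%g <= 2 * sigma].

Lemma chain_steps_value e a l : (qe e * word (chain_steps e a l) * (last (e, a) l).2 =
  mixed_value g ((e, a) :: l))%g.
Proof.
have gE e1 : ((if e1 then g else g^-1) = qe e1 * be e1 * (qe (~~ e1))^-1)%g.
  by rewrite /g /qe /be; case: e1; rewrite //= !invgM invgK !mulgA.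
elim: l e a => [|[e' a'] l IH] e a; rewrite /= gE; first by rewrite !mulg1 !mulgA.
by have /= := IH e' a' => <-; rewrite !mulgA.
Qed.

(** With equal signs [a] stands between the two different words; with opposite signs it stands
    between [q^-1] and the same [q], and is nontrivial by reducedness. *)
Lemma junction_good e a e' : good_constant a -> reduced_pair (e, a) (e', 1%g) ->
  jun <= gp 1%g ((qe (~~ e))^-1 * (a * qe e'))%g F.
Proof.
move=> [t1 t2 t3 t4]; rewrite /reduced_pair /=.
have [<- _|ne /= /eqP a1] := eqVneq e e'.
  apply: junction_separated; first exact: qe_size.
  rewrite /qe; case: (e) => //=.
  by move: t3; rewrite /towards gpC => /negP; rewrite -leNgt; have := sigma_ge0; lra.
have -> : e' = ~~ e by case: e ne; case: e'.
by apply: junction_same => //; [exact: qe_size|case: (e)].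
Qed.

Lemma chain_path e a l t : theta <= gp 1%g t^-1%g F ->
  (forall p, p \in (e, a) :: l -> good_constant p.2 /\ good_constant p.2^-1%g) ->
  path reduced_pair (e, a) l ->
  path (turn d a2) t (chain_steps e a l) /\ all (long d a2) (chain_steps e a l).
Proof.
have del := hypc_ge0 d.
elim: l e a t => [|[e' a'] l IH] e a t tF gc.
  move=> _; have lw : leaves_well (be e * (qe (~~ e))^-1)%g.
    exists e, (qe (~~ e))^-1%g; split=> //.
    by have := q_end (qe_size (~~ e)); rewrite -/(qe (~~ e)) /jun; have := lam_ge0; lra.
  by rewrite /= turn_leaves // long_leaves.
move=> /= /andP[red pl].
have [g1 g2] := gc _ (mem_head _ _).
have lw : leaves_well (be e * ((qe (~~ e))^-1 * (a * qe e')))%g.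
  exists e, ((qe (~~ e))^-1 * (a * qe e'))%g; split=> //.
  by have := junction_good g1 red; rewrite /jun; have := lam_ge0; lra.
have be_len : d 1%g (be e) <= lam by rewrite /be; case: (e); rewrite ?dist1V; exact: b_len.
set t' := (be e * _)%g in lw *.
(* The inverse of a step contains the junction of [a^-1] with the signs reversed. *)
have t'F : theta <= gp 1%g t'^-1%g F.
  have := @junction_good (~~ e') a^-1%g (~~ e) g2.
  rewrite negbK /reduced_pair /= reduced_pairV => /(_ red) e1.
  have := gp_lipl d 1%g ((qe e')^-1 * (a^-1 * qe (~~ e)))%g F t'^-1%g.
  by rewrite /t' !invgM !invgK !mulgA dist_mulr dist1V -!mulgA; move: e1; rewrite /jun; lra.
have gc' p : p \in (e', a') :: l -> good_constant p.2 /\ good_constant p.2^-1%g.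
  by move=> pl'; apply: gc; rewrite inE pl' orbT.
have [p1 p2] := IH e' a' t' t'F gc' pl.
by rewrite turn_leaves // p1 long_leaves.
Qed.

(* The chain starts at [1] along [qe e] and ends at the constant
   [(a_k a_0)^-1], which does not point towards [qe e]. *)
Lemma mixed_value_neq1 a0 e a l : path reduced_pair (e, a) l ->
  (forall p, p \in (e, a) :: l -> good_constant p.2 /\ good_constant p.2^-1%g) ->
  good_constant ((last (e, a) l).2 * a0)^-1%g ->
  (a0 * mixed_value g ((e, a) :: l))%g <> 1%g.
Proof.
move=> red gc [c1 c2 _ _] val1; have del := hypc_ge0 d; have s0 := sigma_ge0.
have := tau_ge => -[jun0 ta a20].
have qF : theta <= gp 1%g (qe e)^-1%g F.
  by have := q_end (qe_size e); rewrite -/(qe e) /jun; have := lam_ge0; lra.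
have [p1 p2] := chain_path qF gc red.
have := chain_start a20 p1 p2.
have := q_len (qe_size e); rewrite -/(qe e).
have : (qe e * word (chain_steps e a l))%g = ((last (e, a) l).2 * a0)^-1%g.
  apply: (mulIg (last (e, a) l).2); apply: (mulgI a0).
  by rewrite chain_steps_value val1 invgM mulgVK mulgV.
move=> cE; have := gp_step d (qe e) (word (chain_steps e a l)); rewrite cE.
have : gp 1%g (qe e) ((last (e, a) l).2 * a0)^-1%g <= sigma.
  by rewrite gpC leNgt; apply/negP; move: c1 c2; rewrite /towards /qe; case: (e).
by rewrite /tau /jun /theta in ta *; have := lam_ge0; have := K_ge0; rewrite /a2; lra.
Qed.

End Chain.
End Substitution.

Lemma seq_uniform_bound (R : realType) (T : eqType) (W : seq T) (Q : T -> R -> Prop) :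
  (forall w C C', C <= C' -> Q w C -> Q w C') -> (forall w, w \in W -> exists C, Q w C) ->
  exists C, forall w, w \in W -> Q w C.
Proof.
move=> mono; elim: W => [|v W IH] H; first by exists 0.
have [|C1 C1H] := IH; first by move=> w wW; apply: H; rewrite inE wW orbT.
have [C2 C2H] := H v (mem_head _ _).
exists (Num.max C1 C2) => w; rewrite inE => /orP[/eqP ->|/C1H].
  by apply: mono C2H; rewrite le_max lexx orbT.
by apply: mono; rewrite le_max lexx.
Qed.

(** * Word-length estimates *)

Section WordLengthTheory.
Variables (G : groupType) (S : set G).
Hypothesis gS : generates S.
Implicit Types g h : G.

Lemma word_length1 : word_length S 1%g = 0%N.
Proof.
apply/eqP; rewrite -leqn0; apply/word_length_leP => //.
by exists [::] => //; split=> //; rewrite big_nil.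
Qed.

Lemma word_lengthM g h : (word_length S (g * h)%g <= word_length S g + word_length S h)%N.
Proof.
have /(word_length_leP _ _ gS)[s sg sl] := leqnn (word_length S g).
have /(word_length_leP _ _ gS)[t th tl] := leqnn (word_length S h).
apply/word_length_leP => //; exists (s ++ t); first exact: spells_cat.
by rewrite size_cat leq_add.
Qed.

Lemma word_lengthV g : (word_length S g^-1%g <= word_length S g)%N.
Proof.
have /(word_length_leP _ _ gS)[s [sS <-] sl] := leqnn (word_length S g).
apply/word_length_leP => //; exists (rev [seq x^-1%g | x <- s]); last by rewrite size_rev size_map.
split=> [x|].
  by rewrite mem_rev => /mapP[y /sS + ->]; rewrite invgK; tauto.
elim: s {sS sl} => [|x s IH]; first by rewrite !big_nil invg1.
by rewrite /= rev_cons -cats1 big_cat big_seq1 big_cons IH invgM.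
Qed.

Lemma word_lengthX g n : (word_length S (g ^+ n)%g <= n * word_length S g)%N.
Proof.
elim: n => [|n IH]; first by rewrite expg0 word_length1.
by rewrite expgS mulSn; apply: leq_trans (word_lengthM _ _) _; rewrite leq_add2l.
Qed.

Lemma word_length_marked_word (f b : G) (vs : seq G) (P D : nat) (s : seq bool) (m n : nat) :
  (word_length S f <= m)%N -> (word_length S b <= m)%N ->
  (forall v, v \in vs -> word_length S v <= m)%N -> size s = n ->
  (word_length S (marked_word f b vs P D s) <=
    n * (P * m + m) + (D * m + size vs * (m + D * m)))%N.
Proof.
move=> fm bm vm <-.
have fX i : (word_length S (f ^+ i)%g <= i * m)%N.
  by apply: leq_trans (word_lengthX _ _) _; rewrite leq_mul2l fm orbT.
apply: leq_trans (word_lengthM _ _) _; apply: leq_add.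
  elim: s => [|e s IH] /=; first by rewrite word_length1.
  apply: leq_trans (word_lengthM _ _) _; rewrite mulSn leq_add //.
  apply: leq_trans (word_lengthM _ _) _; rewrite leq_add //.
  rewrite /sgn_power; case: e => //; rewrite expVgn.
  by apply: leq_trans (word_lengthV _) _.
apply: leq_trans (word_lengthM _ _) _; apply: leq_add => //.
elim: vs vm => [|v vs IH] vm /=; first by rewrite word_length1.
apply: leq_trans (word_lengthM _ _) _; rewrite mulSn; apply: leq_add.
  by apply: leq_trans (word_lengthM _ _) _; rewrite leq_add // vm // mem_head.
by apply: IH => w wv; apply: vm; rewrite inE wv orbT.
Qed.

End WordLengthTheory.

Lemma length_arith (P m c r L D : nat) : (D <= c * L.+1)%N ->
  (L * (P * m + m) + (D * m + r * (m + D * m)) <=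
    (P * m + m + (c * m + r * (m + c * m))) * L.+1)%N.
Proof.
move=> Dc.
have Dm : (D * m <= c * m * L.+1)%N by rewrite mulnAC leq_mul2r Dc orbT.
have mL : (m <= m * L.+1)%N by rewrite leq_pmulr.
rewrite mulnDl leq_add //; first by rewrite mulnC leq_mul2l leqnSn orbT.
by rewrite mulnDl leq_add // -mulnA leq_mul2l mulnDl leq_add ?orbT.
Qed.

(** * Choice of the constants *)

Section Assembly.
Variables (R : realType) (G : groupType) (d : hyperbolic_group_metric R G).
Local Notation delta := (hypc d).
Local Notation gp := (gromov_prod d).

Lemma len_random_word (f b : G) (P : nat) (s : seq bool) (L : nat) : size s = L ->
  d 1%g (random_word f b P s) <= L%:R * (d 1%g (f ^+ P)%g + d 1%g b).
Proof.
move=> <-; elim: s => [|e s IH]; first by rewrite /= distxx mul0r.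
rewrite /= -natr1 mulrDl mul1r.
have := len_mul d (sgn_power f P e * b)%g (random_word f b P s).
have := len_mul d (sgn_power f P e) b.
rewrite len_sgn_power.
by lra.
Qed.

Lemma short_substitution (S : set G) : generates S -> acylindrical_metric d ->
  three_directions d ->
  (forall K : set G, finite_normal_subgroup K -> K = [set 1%g]%classic) ->
  exists A : nat, forall L (a0 : G) e a l, (0 < L)%N -> (4 * (size l + 2) < 2 ^ L)%N ->
    path (@reduced_pair G) (e, a) l ->
    exists2 g, (word_length S g <= A * L.+1)%N & (a0 * mixed_value g ((e, a) :: l))%g <> 1%g.
Proof.
move=> gS d_acyl dir triv.
have [k [f0 f0k]] := exists_lox dir.
have [f fk fw] := wpd_power d_acyl f0k.
have [b nb] := exists_not_axis_stab fk dir.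
have moved := exists_moved_axis fk fw d_acyl nb triv.
have [vs [D0 [nvs vsH]]] := exists_marker fk fw d_acyl moved nb.
pose W := b :: b^-1%g :: vs.
have nW w : w \in W -> ~ axis_stab f w.
  rewrite !inE => /orP[/eqP ->|/orP[/eqP ->|/nvs]] //.
  by move=> /axis_stabV; rewrite invgK.
have [K W_gp] : exists K, forall w, w \in W -> forall f1 f2 i j, sgn f f1 -> sgn f f2 ->
    gp 1%g (f1 ^+ i)%g (w * f2 ^+ j)%g <= K.
  apply: seq_uniform_bound => [w C C' CC H f1 f2 i j s1 s2|w wW].
    exact: le_trans (H _ _ _ _ s1 s2) CC.
  have [C CH] := axis_gp_bound fk fw (nW w wW).
  by exists C => f1 f2 i j; exact: CH.
have [lam W_len] : exists C, forall w, w \in W -> d 1%g w <= C.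
  apply: seq_uniform_bound => [w C C' CC H|w _]; first exact: le_trans H CC.
  by exists (d 1%g w).
have bW : b \in W by rewrite mem_head.
have vsW : {subset vs <= W} by move=> v vv; rewrite !inE vv !orbT.
have lam0 : 0 <= lam by apply: le_trans (W_len b bW); exact: dist_ge0.
have K0 := gp_bound_ge0 bW W_gp.
have del := hypc_ge0 d; have k0 := lox_ge0 fk.
have [P PH] := exists_nat_ge (lam + 2 * (K + lam) + 3 * delta + k + 1).
have [C C0 segH] := long_segment_stab fk fw.
pose beta := d 1%g (f ^+ P)%g + d 1%g b.
have beta0 : 0 <= beta by apply: addr_ge0; exact: dist_ge0.
pose kap := K + lam + 2 * delta + lam.
pose jun := lam + 2 * (K + 2 * delta) + 3 * delta + 1 + lam.
(* Twice [tau] is [4 * (L%:R * beta)] plus constants, so the slope [5 * beta] suffices for [D]; [c0]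
   absorbs the constants. *)
have [c1 c1H] := exists_nat_ge (5 * beta).
have [c0 c0H] := exists_nat_ge
  (4 * (k + 3 * delta) + 4 * jun + 8 * delta + 4 * kap + 4 * delta + C + 1).
pose c2 := (c0 + D0 + P)%N.
pose m := (word_length S f + word_length S b + \sum_(v <- vs) word_length S v)%N.
exists (2 * ((P * m + m) + ((c1 + c2) * m + size vs * (m + (c1 + c2) * m))) + m)%N.
move=> L a0 e a l L0 lL red.
pose D := (c1 * L + c2)%N.
have [DP DD0] : (P <= D)%N /\ (D0 <= D)%N.
  by rewrite /D /c2 addnA leq_addl -addnA addnCA -addnA addnCA leq_addr.
pose sigma := L%:R * beta + k + 3 * delta.
have Lb0 : 0 <= L%:R * beta by rewrite mulr_ge0.
have sigma0 : 0 <= sigma by rewrite /sigma; lra.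
have DL : 5 * (L%:R * beta) + 4 * (k + 3 * delta) + 4 * jun + 8 * delta + 4 * kap +
    4 * delta + C + 1 <= D%:R.
  have : L%:R * (5 * beta) <= L%:R * c1%:R by rewrite ler_wpM2l.
  rewrite /D /c2 !natrD natrM; have := ler0n R D0; have := ler0n R P.
  by rewrite (mulrC c1%:R) mulrCA; move: c0H; lra.
have fD := fk.2 D.
have jun0 : 0 <= jun by rewrite /jun; lra.
have kap0 : 0 <= kap by rewrite /kap; lra.
pose q := marked_word f b vs P D; pose F := (f ^- D)%g.
have cons (s : seq bool) : size s = L -> exists e' s', s = e' :: s'.
  by case: s => [e1|e' s' _]; [move: L0; rewrite -e1|exists e', s'].
have q_end s : size s = L -> jun + delta <= gp 1%g (q s)^-1%g F.
  move=> /cons[e' [s' ->]].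
  have : d 1%g (f ^+ D)%g - kap <= gp 1%g (q (e' :: s'))^-1%g F.
    exact: (marked_word_end fk lam0 bW vsW W_gp W_len PH DP e' s').
  by lra.
have q_sep s s' : size s = L -> size s' = L -> s <> s' -> gp 1%g (q s) (q s') <= sigma - delta.
  move=> sL s'L nss; have ss' := etrans sL (esym s'L).
  have := marked_word_sep fk lam0 bW vsW W_gp W_len PH DP ss' nss.
  by rewrite -/q sL /sigma -/beta; lra.
pose tau := 2 * sigma + 2 * jun + 4 * delta.
have q_len s : size s = L -> tau < d 1%g (q s).
  move=> sL; have := len_random_word f b P sL; have [e' [s' es]] := cons s sL; rewrite es.
  have : d 1%g (f ^+ D)%g - d 1%g (random_word f b P (e' :: s')) - 2 * kap <= d 1%g (q (e' :: s')).
    exact: (marked_word_len fk lam0 bW vsW W_gp W_len PH DP e' s').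
  by rewrite -/beta /tau /sigma; lra.
have tau0 : 0 <= tau by rewrite /tau /jun; lra.
have q_fixed s c : size s = L -> d 1%g c <= tau -> d (q s) (c * q s)%g <= tau -> c = 1%g.
  move=> /cons[e' [s' ->]]; apply: (marked_word_fixed fk lam0 bW vsW W_gp W_len PH DP segH _ tau0).
    exact: vsH.
  by rewrite -/kap /tau /sigma; lra.
have bF : gp 1%g F (b * F)%g <= K.
  by have := W_gp b bW f^-1%g f^-1%g D D; rewrite expVgn; apply; right.
have bVF : gp 1%g F (b^-1 * F)%g <= K.
  have bVW : b^-1%g \in W by rewrite !inE eqxx orbT.
  by have := W_gp b^-1%g bVW f^-1%g f^-1%g D D; rewrite expVgn; apply; right.
pose c := ((last (e, a) l).2 * a0)^-1%g.
(* The constants, the closing element [c] and all inverses make [2 * (size l + 2)] elements, whence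
   the factor 4 in the condition on [L]. *)
pose Z := c :: [seq p.2 | p <- (e, a) :: l].
pose Y := Z ++ [seq z^-1%g | z <- Z].
have [|s [s' [sL s'L YH]]] := choose_pair q_sep (Y := Y).
  by move: lL; rewrite /Y size_cat !size_map /= size_map addn2 addnn -mul2n mulnA.
have good z : z \in Y -> z^-1%g \in Y -> good_constant d q sigma s s' z.
  move=> zY zVY; have [t1 t2 t3] := YH _ zY; have [_ _ t4] := YH _ zVY.
  by split=> //; exact: towards_swap.
have ZY z : z \in Z -> z \in Y /\ z^-1%g \in Y.
  by move=> zZ; rewrite /Y !mem_cat zZ (map_f (fun z => z^-1%g)) // orbT.
exists (q s * b * (q s')^-1)%g; last first.
  apply: (mixed_value_neq1 K0 lam0 sigma0 q_end q_len q_fixed bF bVF (W_len b bW) sL s'L red).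
    move=> p pl; have [z1 z2] : p.2 \in Y /\ p.2^-1%g \in Y.
      by apply: ZY; rewrite inE (map_f (fun p : bool * G => p.2)) ?orbT.
    by split; apply: good; rewrite ?invgK.
  by have [z1 z2] := ZY c (mem_head _ _); exact: good.
have fm : (word_length S f <= m)%N by rewrite /m -addnA leq_addr.
have bm : (word_length S b <= m)%N by rewrite /m addnAC leq_addl.
have vm v : v \in vs -> (word_length S v <= m)%N.
  by move=> vv; rewrite /m; apply: leq_trans (leq_addl _ _); rewrite (big_rem v) //= leq_addr.
have qm t : size t = L -> (word_length S (q t) <=
    (P * m + m + ((c1 + c2) * m + size vs * (m + (c1 + c2) * m))) * L.+1)%N.
  move=> tL; apply: leq_trans (word_length_marked_word gS P D fm bm vm tL) _.
  apply: length_arith; rewrite /D mulnDl leq_add //; first by rewrite leq_mul2l leqnSn orbT.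
  by rewrite leq_pmulr.
apply: leq_trans (word_lengthM gS _ _) _; rewrite mulnDl -mulnA mul2n -addnn addnAC.
apply: leq_add; last exact: leq_trans (word_lengthV gS _) (qm s' s'L).
apply: leq_trans (word_lengthM gS _ _) _; apply: leq_add; first exact: qm.
by apply: leq_trans bm _; rewrite leq_pmulr.
Qed.

End Assembly.

(** * Mixed words and orbit metrics *)

Section NormalForm.
Local Open Scope quotient_scope.
Variable G : groupType.
Implicit Types (g h a : G) (l : seq (bool * G)) (u v : pre_word G).
Local Open Scope group_scope.

Fixpoint letters l : pre_word G :=
  if l is p :: l' then [:: inr p.1, inl p.2 & letters l'] else [::].

Lemma eval_letters g l : eval_word g (letters l) = mixed_value g l.
Proof.
elim: l => [|[e a] l IH]; first exact: big_nil.
by rewrite /eval_word !big_cons -/(eval_word g _) IH /= mulgA; case: e.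
Qed.

Lemma word_eq_cons x u v : word_eq u v -> word_eq (x :: u) (x :: v).
Proof. by move=> uv; apply: (@WordCat _ [:: x] [:: x]) => //; exact: WordRefl. Qed.

Lemma word_eq_catr u u' v : word_eq u u' -> word_eq (u ++ v) (u' ++ v).
Proof. by move=> uu; apply: WordCat => //; exact: WordRefl. Qed.

(** Letters are added on the left: a constant merges with the leading one, and a variable starts a
    new syllable or cancels the next variable. *)
Lemma normal_form u : exists a0 l,
  [/\ sorted (@reduced_pair G) l, (size l <= size u)%N & word_eq u (inl a0 :: letters l)].
Proof.
elim: u => [|x u [a0 [l [sl su ul]]]].
  by exists 1, [::]; split=> //; apply: WordSym; exact: WordOne.
case: x => [g|b].
  exists (g * a0), l; split=> //; first exact: leqW.
  apply: (WordTrans (word_eq_cons _ ul)).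
  exact: (word_eq_catr (letters l) (WordMul g a0)).
have push : word_eq (inr b :: u) (inl 1 :: letters ((b, a0) :: l)).
  apply: (WordTrans (word_eq_cons _ ul)).
  exact: WordSym (word_eq_catr (letters ((b, a0) :: l)) (WordOne G)).
case: l sl su ul push => [|[e a] l] sl su ul push.
  by exists 1, [:: (b, a0)]; split.
have [red|] := boolP (reduced_pair (b, a0) (e, a)).
  by exists 1, [:: (b, a0), (e, a) & l]; split=> //=; rewrite red.
rewrite /reduced_pair /= negb_or negbK => /andP[be /eqP a01].
exists a, l; split; [exact: path_sorted sl|by apply: leq_trans (leqnSn _) (leqW su)|].
apply: (WordTrans (word_eq_cons _ ul)); rewrite a01 /=.
have -> : e = ~~ b by move: be; case: (b); case: (e).
apply: (WordTrans (v := [:: inr b; inr (~~ b)] ++ inl a :: letters l)).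
  apply: word_eq_cons.
  exact: (word_eq_catr (inr (~~ b) :: inl a :: letters l) (WordOne G)).
exact: (word_eq_catr _ (WordCancel G b)).
Qed.

Lemma mixed_word_pre_word (S : set G) (w : mixed_word G) n : generates S ->
  (word_length (mixed_generators S) w <= n)%N ->
  exists2 u, w = \pi_(mixed_word G) u & (size u <= n)%N.
Proof.
move=> gS /(word_length_leP _ _ (mixed_generates gS))[s [sS <-] sn].
suff [u -> us] : exists2 u, \big[*%g/1]_(a <- s) a = \pi_(mixed_word G) u & size u = size s.
  by exists u; rewrite ?us.
elim: s sS {sn} => [|x s IH] sS; first by exists [::]; rewrite ?big_nil.
have [u eu us] := IH (fun y ys => sS y (mem_behead (s := x :: s) ys)).
have [y xy] : exists y, x = \pi_(mixed_word G) [:: y].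
  have inv z : x^-1 = \pi_(mixed_word G) [:: z] -> exists y, x = \pi_(mixed_word G) [:: y].
    by move=> xz; exists (inv_letter z); rewrite -[x]invgK xz; exact: mw_inv_pi.
  case: (sS x (mem_head _ _)) => -[].
  - by move=> [g _ <-]; exists (inl g).
  - by move=> ->; exists (inr true).
  - by move=> [g _ xg]; apply: (inv (inl g)).
  - by move=> xg; apply: (inv (inr true)).
exists (y :: u); last by rewrite /= us.
by rewrite big_cons eu xy; exact: mw_mul_pi.
Qed.

End NormalForm.

(** * Orbit metrics and limit points *)

Section OrbitMetric.
Local Open Scope card_scope.
Local Open Scope classical_set_scope.
Variables (R : realType) (G : groupType) (X : metricType R) (act : G -> X -> X).
Hypotheses (hypX : gromov_hyperbolic X) (isoX : isometric_action act).
Variable o : X.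

Let orbit_dist (g h : G) : R := mdist (act g o) (act h o).

Lemma orbit_metric : exists d : hyperbolic_group_metric R G, forall g h, d g h = orbit_dist g h.
Proof.
have [delta deltaH] := hypX; have [_ actM actI] := isoX.
unshelve eexists; first apply: (@HyperbolicGroupMetric _ _ orbit_dist `|delta|).
- by move=> x; exact: mdistxx.
- by move=> x y; exact: metric_sym.
- by move=> x y z; exact: metric_triangle.
- by move=> g x y; rewrite /orbit_dist !actM actI.
- exact: normr_ge0.
- move=> p x y z; apply: le_trans (deltaH (act p o) (act x o) (act y o) (act z o)).
  by rewrite lerD2l lerN2 ler_norm.
by [].
Qed.

Variable d : hyperbolic_group_metric R G.
Hypothesis dE : forall g h, d g h = orbit_dist g h.

Lemma gp_orbit g h : gromov_prod d 1%g g h = gromov_product o (act g o) (act h o).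
Proof. by have [act1 _ _] := isoX; rewrite /gromov_prod !dE /orbit_dist act1. Qed.

Lemma uniq_seq_card (T : eqType) (A : set T) N (s : seq T) :
  A #<= `I_N -> uniq s -> (forall a, a \in s -> A a) -> (size s <= N)%N.
Proof.
move=> /pcard_leP[f] us sA.
rewrite -(size_map f) -[N in (_ <= N)%N](size_iota 0); apply: uniq_leq_size.
  rewrite map_inj_in_uniq // => x y /sA Ax /sA Ay; move=> /'inj_f; apply; exact/mem_set.
by move=> _ /mapP[x /sA Ax ->]; rewrite mem_iota; have := 'funS_f Ax.
Qed.

Lemma orbit_acylindrical : acylindrical act -> acylindrical_metric d.
Proof.
move=> acX e e0; have [r [N [_ rN]]] := acX e e0; have [_ actM _] := isoX.
exists r, N => x y; rewrite dE => xy s us sH.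
apply: (uniq_seq_card (rN _ _ xy) us) => k /sH.
by rewrite !dE /orbit_dist !actM.
Qed.

Lemma not_card_le2 (T : Type) (A : set T) : ~ (A #<= `I_2) ->
  exists x y z, [/\ A x, A y & A z] /\ [/\ x <> y, x <> z & y <> z].
Proof.
move=> A2; apply: contrapT => none; apply: A2.
have card2 x y : A `<=` [set x; y] -> A #<= `I_2.
  move=> Axy; pose f (i : nat) := if i == 0%N then x else y.
  apply: card_le_trans (card_image_le f `I_2); apply: subset_card_le => z /Axy[] ->.
    by exists 0%N.
  by exists 1%N.
have [[x Ax]|noA] := pselect (exists x, A x); last first.
  by have -> : A = set0; [apply/seteqP; split=> // x Ax; case: noA; exists x|exact: card_ge0].
have [[y [Ay xy]]|no2] := pselect (exists y, A y /\ x <> y); last first.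
  apply: (card2 x x) => z Az; left; apply: contrapT => zx.
  by apply: no2; exists z; split=> // xz; apply: zx.
apply: (card2 x y) => z Az; apply: contrapT => nz; apply: none; exists x, y, z.
split=> //; split=> // e; apply: nz; [left|right]; exact: esym.
Qed.

(** Some products at arbitrarily late indices fall below [M]; a large product at other late indices
    would propagate to them, since each sequence converges. *)
Lemma not_same_limit (u v : nat -> G) (uX := fun n => act (u n) o) (vX := fun n => act (v n) o) :
  converges_to_infinity o uX -> converges_to_infinity o vX -> ~ same_limit o uX vX ->
  exists (C : R) N, forall m n, (N <= m)%N -> (N <= n)%N -> gromov_prod d 1%g (u m) (v n) <= C.
Proof.
move=> cu cv nuv; have del := hypc_ge0 d.
have [M MH] : exists M : R, forall N, exists m n, [/\ (N <= m)%N, (N <= n)%N &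
    gromov_prod d 1%g (u m) (v n) < M].
  apply: contrapT => none; apply: nuv => M; apply: contrapT => noN; apply: none.
  exists M => N; apply: contrapT => nomn; apply: noN; exists N => m n Nm Nn.
  by rewrite -gp_orbit leNgt; apply/negP => ?; apply: nomn; exists m, n.
have [N1 N1H] := cu (M + 2 * hypc d); have [N2 N2H] := cv (M + 2 * hypc d).
exists (M + 2 * hypc d), (maxn N1 N2) => m n; rewrite !geq_max => /andP[m1 m2] /andP[n1 n2].
have [m' [n' [+ + mn]]] := MH (maxn N1 N2); rewrite !geq_max => /andP[m1' m2'] /andP[n1' n2'].
rewrite leNgt; apply/negP => H.
have e1 : M + 2 * hypc d <= gromov_prod d 1%g (u m') (u m) by rewrite gp_orbit; exact: N1H.
have e2 : M + 2 * hypc d <= gromov_prod d 1%g (v n) (v n') by rewrite gp_orbit; exact: N2H.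
have e3 := gp_ge e1 (ltW H).
have e4 : M + 2 * hypc d - hypc d <= gromov_prod d 1%g (v n) (v n') by lra.
by have := gp_ge e3 e4; lra.
Qed.

Lemma same_limit_trans (u v w : nat -> X) :
  same_limit o u v -> same_limit o v w -> same_limit o u w.
Proof.
move=> uv vw M; have [delta deltaH] := hypX.
have [N1 N1H] := uv (M + delta); have [N2 N2H] := vw (M + delta).
exists (maxn N1 N2) => m n; rewrite !geq_max => /andP[m1 m2] /andP[n1 n2].
have := deltaH o (u m) (v (maxn N1 N2)) (w n).
have e1 := N1H m (maxn N1 N2) m1 (leq_maxl _ _); have e2 := N2H (maxn N1 N2) n (leq_maxr _ _) n2.
have : M + delta <= Num.min (gromov_product o (u m) (v (maxn N1 N2)))
    (gromov_product o (v (maxn N1 N2)) (w n)) by rewrite le_min e1.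
by lra.
Qed.

Lemma same_limit_sym (u v : nat -> X) : same_limit o u v -> same_limit o v u.
Proof.
move=> uv M; have [N NH] := uv M; exists N => m n Nm Nn; have := NH n m Nn Nm.
by rewrite /gromov_product (metric_sym (u n) (v m)) (addrC (mdist (u n) o)).
Qed.

Lemma boundary_point_eq (u v : nat -> X) :
  same_limit o u v -> boundary_point o u = boundary_point o v.
Proof.
move=> uv; apply/seteqP; split=> w [cw sw]; split=> //.
  exact: same_limit_trans (same_limit_sym uv) sw.
exact: same_limit_trans uv sw.
Qed.

Lemma orbit_three_directions : ~ (limit_set act o #<= `I_2) -> three_directions d.
Proof.
move=> /not_card_le2[_ [_ [_ [[[u [cu uo] <-] [v [cv vo] <-] [w [cw wo] <-]] [uv uw vw]]]]].
have orb (x : nat -> X) : (forall n, exists g, x n = act g o) ->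
    exists g : nat -> G, x = (fun n => act (g n) o).
  by move=> /choice[g gH]; exists g; apply/funext.
have [g ug] := orb _ uo; have [h vh] := orb _ vo; have [k wk] := orb _ wo.
subst u v w.
have [C1 [N1 H1]] := not_same_limit cu cv (fun s => uv (boundary_point_eq s)).
have [C2 [N2 H2]] := not_same_limit cu cw (fun s => uw (boundary_point_eq s)).
have [C3 [N3 H3]] := not_same_limit cv cw (fun s => vw (boundary_point_eq s)).
exists (Num.max C1 (Num.max C2 C3)) => r.
have [M1 L1] := cu r; have [M2 L2] := cv r; have [M3 L3] := cw r.
pose n := (N1 + N2 + N3 + M1 + M2 + M3)%N.
exists (g n), (h n), (k n); rewrite -!(gpxx d) !gp_orbit; split; split.
- by apply: L1; rewrite /n; lia.
- by apply: L2; rewrite /n; lia.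
- by apply: L3; rewrite /n; lia.
- by rewrite -gp_orbit !le_max H1 // /n; lia.
- by rewrite -gp_orbit !le_max H2 ?orbT // /n; lia.
- by rewrite -gp_orbit !le_max H3 ?orbT // /n; lia.
Qed.

End OrbitMetric.

Theorem theorem1p1 (R : realType) (G : groupType)
    (G_fg : finitely_generated G)
    (G_ah : acylindrically_hyperbolic R G)
    (G_rad : is_finite_radical [set 1%g : G]) :
  sharply_mif R G.
Proof.
(* Every finite normal subgroup contains the trivial one, which is maximal. *)
have triv (K : set G) : finite_normal_subgroup K -> K = [set 1%g]%classic.
  move=> nK; have [[_ max1] _] := G_rad; apply: max1 => // _ ->.
  by case: nK.
have [X [act [hypX isoX acX [p no]]]] := G_ah.
have [d dE] := orbit_metric hypX isoX p.
have d_acyl := orbit_acylindrical isoX dE acX.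
have d_dir := orbit_three_directions hypX isoX dE no.
have key (S : set G) : generates S -> exists A : nat, forall (w : mixed_word G) n, (0 < n)%N ->
    w <> 1%g -> (word_length (mixed_generators S) w <= n)%N ->
    exists2 g, mw_eval g w <> 1%g & (word_length S g <= A * (trunc_log 2 n).+1.+4)%N.
  move=> gS; have [A AH] := short_substitution gS d_acyl d_dir triv.
  exists A => w n n0 w1 /(mixed_word_pre_word gS)[u wu un].
  have [a0 [l [sl lu ul]]] := normal_form u.
  have ev g : mw_eval g w = (a0 * mixed_value g l)%g.
    rewrite wu mw_eval_pi (eval_word_congr g ul) -eval_letters.
    by rewrite /eval_word big_cons.
  case: l sl lu ul ev => [|[e a] l] sl lu ul ev.
    (* A word without variable is a nontrivial constant, so any substitution works. *)
    exists 1%g; last by rewrite word_length1.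
    rewrite ev mulg1 => a01; apply: w1; rewrite wu; apply/mixed_wordP.
    by apply: WordTrans ul _; rewrite a01; exact: WordOne.
  (* With [t = trunc_log 2 n], [size l < n] and [n < 2 ^ t.+1] give
     [4 * (size l + 2) <= 8 * n < 2 ^ (t + 4)]. *)
  have [||g gl gv] := AH (trunc_log 2 n).+4 a0 e a l _ _ sl; first by [].
  - have := trunc_log_ltn n (isT : (1 < 2)%N); rewrite !expnS.
    by have /= := leq_trans lu un; lia.
  by exists g; rewrite ?ev.
have mif : mixed_identity_free G.
  have [S [_ gS]] := G_fg; have [A AH] := key S gS.
  move=> w w1; have [g gw _] := AH w (word_length (mixed_generators S) w).+1 isT w1 (leqnSn _).
  by exists g.
split=> // S fS gS; have [A AH] := key S gS.
have l2 : 0 < ln (2 : R) by rewrite ln_gt0 // ltr1n.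
(* For [n >= 2], both [t] and [1] are at most [ln n / ln 2], so [t + 5] is at most six times that;
   the added [1] keeps the constant positive when [A] is [0]. *)
exists (6 * A%:R / ln 2 + 1); first by rewrite ltr_wpDl // divr_ge0 ?mulr_ge0 // ltW.
move=> n n2; have n0 : (0 < n)%N by exact: ltnW.
set m := (A * (trunc_log 2 n).+1.+4)%N.
have : (mif_growth S n <= m)%N.
  by apply/mif_growthP => // w w1 wn; exact: AH.
rewrite -(ler_nat R) => /le_trans; apply.
set t := trunc_log 2 n; have t_le : t%:R * ln 2 <= ln n%:R :> R.
  rewrite mulr_natl -lnXn // ler_ln ?posrE ?exprn_gt0 ?ltr0n //.
  by rewrite -natrX ler_nat trunc_logP.
have n_le : ln 2 <= ln n%:R :> R by rewrite ler_ln ?posrE ?ltr0n // ler_nat.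
rewrite mulrDl mul1r; apply: (@le_trans _ _ (6 * A%:R / ln 2 * ln n%:R)); last by lra.
rewrite mulrAC ler_pdivlMr // /m -/t.
have -> : (A * t.+1.+4)%:R = A%:R * (t%:R + 5) :> R.
  by rewrite natrM -addn4 -addn1 !natrD; congr (_ * _); lra.
rewrite -mulrA (mulrC 6) -!mulrA ler_wpM2l //; lra.
Qed.
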